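(* Let $\mathbb F$ be a field of characteristic $p$ with $p=0$ or $p>2dr\delta$, and assume $d\ge(r+1)^4\delta$. Let $f,f_1,\dots,f_r$ and $L=\sum_{i=0}^rQ_i\nabla^i$ be as in the context, and let $\phi_1,\dots,\phi_m$ be the irreducible factors of $Q_r$ over $\mathbb F$. Then there exists a deterministic algorithm that, given a basis $\{h_1,\dots,h_r\}$ of $\ker L=\{g\in\mathbb F[x]:L(g)=0\}$ and the polynomials $\phi_1,\dots,\phi_m$, outputs the set $\{f_1^d,\dots,f_r^d\}$ in time $\mathrm{poly}(m,r,\delta,d)$, or $\mathrm{poly}(m,r,\delta,d,\log p)$ when $p>0$.
   Context: Let $r,d,\delta\in\mathbb N$, $\nabla=\frac{d}{dx}$. Let $f=\sum_{i=1}^r\alpha_if_i(x)^d$ with $\alpha_i\in\mathbb F$, each $f_i\in\mathbb F[x]$ monic of degree at most $\delta$, and the representation minimal: $f$ cannot be written as $\sum_{i=1}^{r'}\beta_ig_i^d$ with $r'<r$, $\beta_i\in\mathbb F$, $\deg g_i\le\delta$. Let $M$ be the $(r+1)\times(r+1)$ matrix with rows $i=0,\dots,r$ equal to $(\nabla^if,\nabla^if_1^d,\dots,\nabla^if_r^d)$; let $W_i$ be the determinant of the submatrix deleting row $i$ and the first column; let $G=\gcd(W_0,\dots,W_r)$ and $P_i=(-1)^iW_i/G$. $L=\sum_iQ_i\nabla^i$ with $Q_i=P_i/c$, where $c$ is the leading coefficient of $P_r$ (so $Q_r$ is monic).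
   Formalization: When p>0, ker L in F[x] is closed under multiplication by x^p, so for r≥1 it is infinite-dimensional and has no basis of r elements; there ker L is taken on polynomials of degree less than p. Time counts field operations and equality tests at unit cost. *)

(* Defs.v *)
From HB Require Import structures.
From mathcomp Require Import all_boot all_order all_algebra.

Set Implicit Arguments.
Unset Strict Implicit.
Unset Printing Implicit Defensive.

Import GRing.Theory.
Local Open Scope ring_scope.

(* ------------------------------------------------------------------------ *)
(* Model of computation: while programs on an algebraic RAM.  The syntax    *)
(* does not mention the field, so one program runs over every field; its    *)
(* only field constants are 0 and 1.  Memory consists of two-index arrays   *)
(* of naturals and of field elements, named by literal numbers; indices are *)
(* computed, so addressing is indirect.  Time is the number of operations   *)
(* performed, each field operation or field equality test costing 1.        *)
(* Naturals have only +, truncated - and comparisons: there is no unit-cost *)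
(* multiplication, so a run of t steps handles integers of O(t) bits more   *)
(* than those it started with.                                              *)
(* ------------------------------------------------------------------------ *)

Inductive nexpr : Type :=
| NConst of nat
| NGet of nat & nexpr & nexpr          (* array name, two indices *)
| NAdd of nexpr & nexpr
| NSub of nexpr & nexpr.

Inductive fexpr : Type :=
| FZero
| FOne
| FGet of nat & nexpr & nexpr
| FAdd of fexpr & fexpr
| FOpp of fexpr
| FMul of fexpr & fexpr
| FInv of fexpr.                       (* with 0^-1 = 0 *)

Inductive bexpr : Type :=
| NLe of nexpr & nexpr
| NEq of nexpr & nexpr
| FEq of fexpr & fexpr
| BNot of bexpr
| BAnd of bexpr & bexpr.

Inductive cmd : Type :=
| Skip
| NSet of nat & nexpr & nexpr & nexpr  (* array name, two indices, value *)
| FSet of nat & nexpr & nexpr & fexpr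
| Seq of cmd & cmd
| If of bexpr & cmd & cmd
| While of bexpr & cmd.

Record state (F : Type) : Type := State {
  nmem : nat -> nat -> nat -> nat;
  fmem : nat -> nat -> nat -> F
}.

Definition upd (T : Type) (mem : nat -> nat -> nat -> T) (a i j : nat) (v : T) :
    nat -> nat -> nat -> T :=
  fun a' i' j' => if [&& a' == a, i' == i & j' == j] then v else mem a' i' j'.

Fixpoint neval (F : Type) (s : state F) (e : nexpr) : nat :=
  match e with
  | NConst n => n
  | NGet a i j => nmem s a (neval s i) (neval s j)
  | NAdd e1 e2 => (neval s e1 + neval s e2)%N
  | NSub e1 e2 => (neval s e1 - neval s e2)%N
  end.

Fixpoint feval (F : fieldType) (s : state F) (e : fexpr) : F :=
  match e with
  | FZero => 0
  | FOne => 1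
  | FGet a i j => fmem s a (neval s i) (neval s j)
  | FAdd e1 e2 => feval s e1 + feval s e2
  | FOpp e1 => - feval s e1
  | FMul e1 e2 => feval s e1 * feval s e2
  | FInv e1 => (feval s e1)^-1
  end.

Fixpoint beval (F : fieldType) (s : state F) (b : bexpr) : bool :=
  match b with
  | NLe e1 e2 => (neval s e1 <= neval s e2)%N
  | NEq e1 e2 => neval s e1 == neval s e2
  | FEq e1 e2 => feval s e1 == feval s e2
  | BNot b1 => ~~ beval s b1
  | BAnd b1 b2 => beval s b1 && beval s b2
  end.

Fixpoint ncost (e : nexpr) : nat :=
  match e with
  | NConst _ => 1%N
  | NGet _ e1 e2 | NAdd e1 e2 | NSub e1 e2 => (ncost e1 + ncost e2).+1
  end.

Fixpoint fcost (e : fexpr) : nat :=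
  match e with
  | FZero | FOne => 1%N
  | FGet _ i j => (ncost i + ncost j).+1
  | FAdd e1 e2 | FMul e1 e2 => (fcost e1 + fcost e2).+1
  | FOpp e1 | FInv e1 => (fcost e1).+1
  end.

Fixpoint bcost (b : bexpr) : nat :=
  match b with
  | NLe e1 e2 | NEq e1 e2 => (ncost e1 + ncost e2).+1
  | FEq e1 e2 => (fcost e1 + fcost e2).+1
  | BNot b1 => (bcost b1).+1
  | BAnd b1 b2 => (bcost b1 + bcost b2).+1
  end.

(* [exec c s s' t]: started in s, the program c halts in s' after time t. *)
Inductive exec (F : fieldType) : cmd -> state F -> state F -> nat -> Prop :=
| ExecSkip s : exec Skip s s 1%N
| ExecNSet s a i j e :
    exec (NSet a i j e) s
      (State (upd (nmem s) a (neval s i) (neval s j) (neval s e)) (fmem s))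
      (ncost i + ncost j + ncost e).+1
| ExecFSet s a i j e :
    exec (FSet a i j e) s
      (State (nmem s) (upd (fmem s) a (neval s i) (neval s j) (feval s e)))
      (ncost i + ncost j + fcost e).+1
| ExecSeq s1 s2 s3 c1 c2 t1 t2 :
    exec c1 s1 s2 t1 -> exec c2 s2 s3 t2 -> exec (Seq c1 c2) s1 s3 (t1 + t2)
| ExecIf s s' b c1 c2 t :
    exec (if beval s b then c1 else c2) s s' t ->
    exec (If b c1 c2) s s' (bcost b + t).+1
| ExecWhileF s b c :
    ~~ beval s b -> exec (While b c) s s (bcost b).+1
| ExecWhileT s1 s2 s3 b c t1 t2 :
    beval s1 b -> exec c s1 s2 t1 -> exec (While b c) s2 s3 t2 ->
    exec (While b c) s1 s3 (bcost b + t1 + t2).+1.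

Lemma exec_deterministic (F : fieldType) (c : cmd) (s s1 s2 : state F)
    (t1 t2 : nat) :
  exec c s s1 t1 -> exec c s s2 t2 -> s1 = s2 /\ t1 = t2.
Proof.
move=> E; elim: E s2 t2 => {c s s1 t1}.
- by move=> s s2 t2 E; inversion E; subst.
- by move=> s a i j e s2 t2 E; inversion E; subst.
- by move=> s a i j e s2 t2 E; inversion E; subst.
- move=> s1 s2 s3 c1 c2 t1 t2 _ IH1 _ IH2 s4 t4 E; inversion E; subst.
  have [? ?] := IH1 _ _ ltac:(eassumption); subst.
  by have [? ?] := IH2 _ _ ltac:(eassumption); subst.
- move=> s s' b c1 c2 t _ IH s4 t4 E; inversion E; subst.
  by have [? ?] := IH _ _ ltac:(eassumption); subst.
- move=> s b c Nb s4 t4 E; inversion E; subst=> //.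
  by match goal with H : is_true (beval s b) |- _ => rewrite H in Nb end.
- move=> s1 s2 s3 b c t1 t2 Hb _ IH1 _ IH2 s4 t4 E; inversion E; subst.
    by match goal with H : is_true (~~ _) |- _ => rewrite Hb in H end.
  have [? ?] := IH1 _ _ ltac:(eassumption); subst.
  by have [? ?] := IH2 _ _ ltac:(eassumption); subst.
Qed.

(* Input convention, for polynomials in dense representation:               *)
(*   natural array 0: the entries (0,0), (1,0), (2,0), (3,0) are r, d,      *)
(*     delta, m;                                                            *)
(*   natural array 1 (resp. 2): entry (i,0) is size (h i) (resp. of phi i); *)
(*   field array 0 (resp. 1): entry (i,j) is the coefficient of 'X^j in     *)
(*     h i (resp. phi i);                                                   *)
(* every other cell holds 0.                                                *)
Definition family_at (I : Type) (T : Type) (x0 : T) (n : nat)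
    (F : 'I_n -> I) (get : I -> T) (i : nat) : T :=
  if insub i is Some k then get (F k) else x0.

Definition init_state (F : fieldType) (r d delta m : nat)
    (h : 'I_r -> {poly F}) (phi : 'I_m -> {poly F}) : state F :=
  State
    (fun a i j =>
       if j != 0%N then 0%N else
       match a with
       | 0%N => nth 0%N [:: r; d; delta; m] i
       | 1%N => family_at 0%N h (fun q : {poly F} => size q) i
       | 2%N => family_at 0%N phi (fun q : {poly F} => size q) i
       | _ => 0%N
       end)
    (fun a i j =>
       match a with
       | 0%N => family_at 0 h (fun q : {poly F} => q`_j) i
       | 1%N => family_at 0 phi (fun q : {poly F} => q`_j) i
       | _ => 0
       end).

(* Output convention: natural array 3 holds at (0,0) the number of output   *)
(* polynomials; the i-th one has its number of coefficients at (i,0) of     *)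
(* natural array 4 and its coefficients in row i of field array 2.          *)
Definition output (F : fieldType) (s : state F) : seq {poly F} :=
  mkseq (fun i => \poly_(j < nmem s 4%N i 0%N) fmem s 2%N i j) (nmem s 3%N 0%N 0%N).

(* ------------------------------------------------------------------------ *)
(* The differential operator attached to a sum of d-th powers               *)
(* ------------------------------------------------------------------------ *)

Definition has_characteristic (F : fieldType) (p : nat) : Prop :=
  if p == 0%N then [pchar F] =i pred0 else p \in [pchar F].

Definition minimal_representation (F : fieldType) (r d delta : nat)
    (f : {poly F}) : Prop :=
  forall (r' : nat) (beta : 'I_r' -> F) (g : 'I_r' -> {poly F}),
    (r' < r)%N -> (forall i, (size (g i) <= delta.+1)%N) ->
    f <> \sum_(i < r') beta i *: g i ^+ d.

Section DiffOp.
Variables (F : fieldType) (r d : nat) (f : {poly F}) (fs : 'I_r -> {poly F}).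

(* Column 0 is f, column k + 1 is fs k ^+ d. *)
Definition Mmx : 'M[{poly F}]_(r.+1) :=
  \matrix_(i, j) (if unlift ord0 j is Some k then fs k ^+ d else f)^`(i).

Definition Wdet (i : 'I_r.+1) : {poly F} := \det (row' i (col' ord0 Mmx)).

(* Only determined up to a nonzero constant, which cancels in Qcoef. *)
Definition Ggcd : {poly F} := \big[@gcdp F/0]_(i < r.+1) Wdet i.

Definition Pcoef (i : 'I_r.+1) : {poly F} := (-1) ^+ i * (Wdet i %/ Ggcd).

Definition Qcoef (i : 'I_r.+1) : {poly F} :=
  (lead_coef (Pcoef ord_max))^-1 *: Pcoef i.

Definition Lop (g : {poly F}) : {poly F} := \sum_(i < r.+1) Qcoef i * g^`(i).

End DiffOp.

(* In characteristic p > 0, L is F['X^p]-linear, so its kernel on all of    *)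
(* F['X] is infinite-dimensional over F as soon as it is nonzero; there the *)
(* kernel is taken on polynomials of degree < p, on which the constants of  *)
(* the derivation are exactly F.  In characteristic 0 it is taken on F['X]. *)
Definition kerL (F : fieldType) (p r d : nat) (f : {poly F})
    (fs : 'I_r -> {poly F}) (g : {poly F}) : Prop :=
  Lop d f fs g = 0 /\ ((0 < p)%N -> (size g <= p)%N).

Definition is_basis (F : fieldType) (n : nat) (V : {poly F} -> Prop)
    (h : 'I_n -> {poly F}) : Prop :=
  [/\ forall i, V (h i),
      forall c : 'I_n -> F, \sum_(i < n) c i *: h i = 0 -> forall i, c i = 0
    & forall g, V g -> exists c : 'I_n -> F, g = \sum_(i < n) c i *: h i].

(* Each irreducible factor is listed once, up to a nonzero constant. *)
Definition irreducible_factors (F : fieldType) (m : nat) (q : {poly F})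
    (phi : 'I_m -> {poly F}) : Prop :=
  [/\ forall j, irreducible_poly (phi j) /\ phi j %| q,
      forall u, irreducible_poly u -> u %| q -> exists j, u %= phi j
    & forall i j, phi i %= phi j -> i = j].

(* Main.v *)
Require Import Defs.
From HB Require Import structures.
From mathcomp Require Import all_boot all_order all_algebra.
From mathcomp Require Import perm zify ring.

Set Implicit Arguments.
Unset Strict Implicit.
Unset Printing Implicit Defensive.

Import GRing.Theory.
Local Open Scope ring_scope.

(* Write V for the span of the powers f_k^d, which is also the span of the given
   basis h.  Every irreducible factor of f_k divides Q_r, because the top term of
   L (f_k^d) has strictly smaller order there than the others; so each f_k is a
   product Phi_e of powers of the monic associates of the phi_j.  A Wronskian argument
   of Mason-Stothers type shows that Phi_e^d divides a combination of the f_k^d only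
   if Phi_e divides every f_k that occurs in it.  Hence {g : g * Phi_e^d in V}, which
   linear algebra computes from h, has dimension #{k : Phi_e | f_k}.  Comparing this
   number with the number of multiples of Phi_e among the f_k already found decides
   whether some new f_k is a multiple of Phi_e, and raising the exponents one after
   the other as long as the answer is yes ends at a new f_k. *)

(** * Linear algebra and the Wronskian *)

(** Only the span of the powers is accessible, and [Phi_e | f_k] is not a linear condition on it.
    Divisibility by [Phi_e ^+ d] is linear, and the Wronskian argument makes the two agree. The
    bound on d is spent there: differentiating r-1 times costs r-1 orders of vanishing, and the
    determinant left over has degree at most r(r-1)delta, so r + r(r-1)delta < d gives the
    contradiction. The characteristic enters through the integers 1, ..., d*delta being nonzero in
    F: derivatives then lower multiplicities by exactly one, and degrees up to d*delta stay distinct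
    as elements of F. The search needs no backtracking because having a new multiple among the f_k
    passes from Phi_e to its divisors: an exponent that cannot be raised now cannot be raised later
    either. All loops have limits that they do not change, so termination and cost are read off the
    syntax and correctness concerns a total function on states. *)

Section Families.
Variable F : fieldType.
Implicit Types (g u : {poly F}).

Definition in_span (I : finType) (w : I -> {poly F}) g : Prop :=
  exists c : I -> F, g = \sum_i c i *: w i.

Definition independent (I : finType) (w : I -> {poly F}) : Prop :=
  forall c : I -> F, \sum_i c i *: w i = 0 -> forall i, c i = 0.

Lemma mx_kernel_exists a b (A : 'M[F]_(a, b)) :
  (b < a)%N -> exists2 v : 'rV_a, v != 0 & v *m A = 0.
Proof.
move=> ltba; have : kermx A != 0.
  by rewrite -mxrank_eq0 mxrank_ker -lt0n subn_gt0 (leq_ltn_trans (rank_leq_col A)).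
by case/rowV0Pn=> v /sub_kermxP vA v0; exists v.
Qed.

(** Steinitz: otherwise the coefficient matrix has more rows than columns, and a left kernel vector
    is a dependence. The index predicates serve to compare the nonzero rows with the k such that
    [Phi_e] divides [f_k]. *)
Lemma independent_card_le (I J : finType) (u : I -> {poly F}) (w : J -> {poly F})
    (A : {pred I}) (B : {pred J}) :
  (forall c : I -> F, \sum_(i in A) c i *: u i = 0 -> {in A, forall i, c i = 0}) ->
  {in A, forall i, exists c : J -> F, u i = \sum_(j in B) c j *: w j} ->
  (#|A| <= #|B|)%N.
Proof.
move=> indep span; rewrite leqNgt; apply/negP => lt_BA.
have [C HC] : exists C : 'I_#|A| -> J -> F,
    forall i, u (enum_val i) = \sum_(j in B) C i j *: w j.
  have H : forall i : 'I_#|A|, exists c : J -> F, u (enum_val i) = \sum_(j in B) c j *: w j.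
    by move=> i; apply: span; apply: enum_valP.
  exact: (fin_all_exists H).
pose M : 'M[F]_(#|A|, #|B|) := \matrix_(i, j) C i (enum_val j).
have [v v0 vM] := mx_kernel_exists M lt_BA.
case/rV0Pn: v0 => i0; apply/negP; rewrite negbK; apply/eqP.
pose c i := if insub i is Some a then v 0 (enum_rank_in (enum_valP i0) (val (a : {x | x \in A}))) else 0.
have cE i : c (enum_val i) = v 0 i.
  rewrite /c insubT; first exact: enum_valP.
  by move=> ? /=; rewrite enum_valK_in.
rewrite -cE; apply: (indep c) => //; last exact: enum_valP.
rewrite big_enum_val /=.
under eq_bigr => i _ do rewrite cE HC scaler_sumr.
rewrite exchange_big /= big1 // => j jB.
under eq_bigr => i _ do rewrite scalerA.
rewrite -scaler_suml -(enum_rankK_in jB jB).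
rewrite (_ : \sum_i _ = (v *m M) 0 (enum_rank_in jB j)).
  by rewrite vM mxE scale0r.
by rewrite [RHS]mxE; apply: eq_bigr => i _; rewrite !mxE.
Qed.

(** The square coefficient matrix of [w] in [h] has trivial left kernel, and its inverse expresses
    [h] in [w]. *)
Lemma independent_same_span n (h w : 'I_n -> {poly F}) :
  independent w -> (forall i, in_span h (w i)) -> forall i, in_span w (h i).
Proof.
move=> indep /fin_all_exists[C HC].
pose M : 'M[F]_n := \matrix_(i, j) C i j.
have Mu : M \in unitmx.
  rewrite -row_free_unit -kermx_eq0; apply/eqP/row_matrixP => k.
  apply/rowP => i; rewrite row0 [RHS]mxE.
  apply: (indep (fun i => row k (kermx M) 0 i)).
  under eq_bigr => a _ do rewrite HC scaler_sumr.
  rewrite exchange_big /= big1 // => j _.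
  under eq_bigr => a _ do rewrite scalerA.
  rewrite -scaler_suml (_ : \sum_i _ = (row k (kermx M) *m M) 0 j).
    by rewrite -row_mul mulmx_ker row0 mxE scale0r.
  by rewrite [RHS]mxE; apply: eq_bigr => a _; rewrite !mxE.
move=> i; exists (fun j => invmx M i j).
under eq_bigr => a _ do rewrite HC scaler_sumr.
rewrite exchange_big /= (eq_bigr (fun j => (i == j)%:R *: h j)) => [|j _].
  rewrite (bigD1 i) //= eqxx scale1r big1 ?addr0 // => j ji.
  by rewrite eq_sym (negPf ji) scale0r.
under eq_bigr => a _ do rewrite scalerA.
rewrite -scaler_suml (_ : \sum_i _ = (invmx M *m M) i j).
  by rewrite mulVmx // mxE.
by rewrite [RHS]mxE; apply: eq_bigr => a _; rewrite !mxE.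
Qed.

End Families.

Section Wronskian.
Variable F : fieldType.
Implicit Types (g u : {poly F}).

Lemma coefM_top (p q : {poly F}) a b :
  (size p <= a.+1)%N -> (size q <= b.+1)%N -> (p * q)`_(a + b) = p`_a * q`_b.
Proof.
move=> sp sq; have ab : (a < (a + b).+1)%N by rewrite ltnS leq_addr.
rewrite coefM (bigD1 (Ordinal ab)) //= addKn big1 ?addr0 // => i.
rewrite -val_eqE /= => neq; have [lt_ia|] := ltnP i a.
  by rewrite [q`__]nth_default ?mulr0 // (leq_trans sq) //; lia.
move=> le_ai; rewrite [p`__]nth_default ?mul0r // (leq_trans sp) //; lia.
Qed.

Lemma coef_XnM_derivn g k t : ('X^k * g^`(k))`_t = g`_t *+ t ^_ k.
Proof.
rewrite coefXnM; case: ltnP => [lt_tk|le_kt]; first by rewrite ffact_small.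
by rewrite coef_derivn subnKC.
Qed.

(** The falling factorial as a polynomial: ['X^k] times the k-th derivative multiplies ['X^n] by its
    value at n. *)
Definition ffact_poly k : {poly F} := \prod_(i < k) ('X - (i%:R)%:P).

Lemma size_ffact_poly k : size (ffact_poly k) = k.+1.
Proof. by rewrite size_prod_XsubC /index_enum -enumT size_enum_ord. Qed.

Lemma ffact_polyE k n : (ffact_poly k).[n%:R] = (n ^_ k)%:R.
Proof.
rewrite /ffact_poly horner_prod ffact_prod.
have [le_kn|lt_nk] := leqP k n.
  rewrite natr_prod; apply: eq_bigr => i _.
  by rewrite !hornerE natrB // (leq_trans _ le_kn) // ltnW.
rewrite (bigD1 (Ordinal lt_nk)) //= !hornerE subrr mul0r.
by rewrite (bigD1 (Ordinal lt_nk)) //= subnn mul0n.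
Qed.

(* The behaviour at infinity: an operator maps X^n + ... to I(n) X^(n+D) + ... for
   some shift D and a nonzero polynomial I (the indicial polynomial) of degree less
   than the number of coefficients; so degrees in the kernel are roots of I. *)
Lemma wronskian_neq0 n (u : 'I_n -> {poly F}) N (a : 'I_n -> {poly F}) :
  independent u -> (forall i, size (u i) <= N.+1)%N ->
  (forall k, (0 < k <= N)%N -> k%:R != 0 :> F) ->
  (forall i, \sum_k a k * (u i)^`(k) = 0) -> forall k, a k = 0.
Proof.
move=> indep szu charF kill k0; apply/eqP; apply: contraT => ak0.
(* Multiplied by ['X^n], the operator is a combination, with coefficients [b k], of operators that
   multiply each monomial by a scalar. *)
pose b (k : 'I_n) := 'X^(n - k) * a k.
have b_size k : (size (b k) <= \max_k size (b k))%N by apply: leq_bigmax.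
have card_n : (0 < #|'I_n|)%N by apply/card_gt0P; exists k0.
have [K bK] := eq_bigmax (fun k => size (b k)) card_n.
move: b_size; rewrite bK => b_size.
have bK_gt0 : (0 < size (b K))%N.
  apply: leq_trans (b_size k0); rewrite size_poly_gt0.
  by rewrite mulf_neq0 // expf_neq0 // polyX_eq0.
pose D := (size (b K)).-1; pose beta k := (b k)`_D.
have betaK : beta K != 0 by rewrite /beta /D -/(lead_coef _) lead_coef_eq0 -size_poly_gt0.
pose P := \sum_(k < n) beta k *: ffact_poly k.
(* The indicial polynomial is nonzero because falling factorials have distinct degrees: look at the
   largest k with [beta k] nonzero. *)
have P0 : P != 0.
  case: (@arg_maxnP _ K (fun k => beta k != 0) (fun k => k : nat) betaK) => k betak maxk.
  apply: contra_neq betak => P0; have := congr1 (fun q : {poly F} => q`_k) P0.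
  rewrite coef0 coef_sum (bigD1 k) //= big1 => [|i ik].
    rewrite coefZ addr0 [X in _ * X](_ : _ = 1) ?mulr1 //.
    have /monicP := monic_prod_XsubC (index_enum 'I_k) xpredT (fun i : 'I_k => (i%:R : F)).
    by rewrite -/(ffact_poly k) /lead_coef size_ffact_poly.
  have [|lt_ki] := ltnP i k => [lt_ik|].
    by rewrite coefZ nth_default ?mulr0 // size_ffact_poly.
  rewrite coefZ; have [->|bi] := eqVneq (beta i) 0; first by rewrite mul0r.
  have := maxk _ bi; move: ik; rewrite -val_eqE /=; lia.
have szP : (size P <= n)%N.
  apply: (leq_trans (size_sum _ _ _)); apply/bigmax_leqP => k _.
  by rewrite (leq_trans (size_scale_leq _ _)) // size_ffact_poly.
(* By [charF] these possible degrees are distinct in F, so as roots of P they number fewer than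
   n. *)
pose Z := [seq z <- iota 0 N.+1 | P.[z%:R] == 0].
have ltZ : (size Z < n)%N.
  apply: leq_trans szP; rewrite -(size_map (fun z => z%:R : F)).
  apply: max_poly_roots => //.
    by apply/allP => _ /mapP[z + ->]; rewrite mem_filter => /andP[].
  rewrite map_inj_in_uniq ?filter_uniq ?iota_uniq // => x y.
  rewrite !mem_filter !mem_iota => /andP[_ lx] /andP[_ ly] /eqP.
  wlog le_xy : x y lx ly / (x <= y)%N.
    by move=> H; case/orP: (leq_total x y) => h; [|rewrite eq_sym => ?; symmetry]; exact: H.
  rewrite eq_sym -subr_eq0 -natrB // => yx0; apply/eqP; move: yx0.
  apply: contraTT => nxy; apply: charF; lia.
(* With fewer than n conditions, some nonzero combination g has zero coefficient at every degree in
   Z; yet its own degree must lie in Z. *)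
pose B : 'M[F]_(n, size Z) := \matrix_(i, z) (u i)`_(nth 0%N Z z).
have [v v0 vB] := mx_kernel_exists B ltZ.
pose g := \sum_i v 0 i *: u i.
have g0 : g != 0.
  apply: contra_neq v0 => g0; apply/rowP => i; rewrite mxE.
  exact: (indep (fun i => v 0 i)).
have szg : (size g <= N.+1)%N.
  apply: (leq_trans (size_sum _ _ _)); apply/bigmax_leqP => k _.
  exact: leq_trans (size_scale_leq _ _) _.
pose s := (size g).-1.
have sg : size g = s.+1 by rewrite prednK // size_poly_gt0.
have gs : g`_s != 0 by rewrite -/(lead_coef g) lead_coef_eq0.
have Ag : \sum_k a k * g^`(k) = 0.
  rewrite (eq_bigr (fun k => \sum_i v 0 i *: (a k * (u i)^`(k)))).
    by rewrite exchange_big big1 //= => i _; rewrite -scaler_sumr kill scaler0.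
  move=> k _; rewrite /g raddf_sum mulr_sumr; apply: eq_bigr => i _.
  by rewrite /= derivnZ scalerAr.
have sZ : s \in Z.
  rewrite mem_filter mem_iota /= add0n -sg szg andbT.
  have : ('X^n * \sum_k a k * g^`(k))`_(D + s) = 0 by rewrite Ag mulr0 coef0.
  rewrite mulr_sumr coef_sum (eq_bigr (fun k => g`_s * (beta k * (s ^_ k)%:R))).
    rewrite -mulr_sumr => /eqP; rewrite mulf_eq0 (negPf gs) /= => /eqP <-.
    apply/eqP; rewrite /P horner_sum; apply: eq_bigr => k _.
    by rewrite hornerZ ffact_polyE.
  move=> k _; have -> : 'X^n * (a k * g^`(k)) = b k * ('X^k * g^`(k)).
    have -> : 'X^n = 'X^(n - k) * 'X^k :> {poly F} by rewrite -exprD subnK // ltnW.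
    by rewrite mulrACA.
  rewrite coefM_top.
  - by rewrite coef_XnM_derivn -[in LHS]mulr_natr mulrCA.
  - by rewrite /D prednK.
  - apply/leq_sizeP => t lt_st; rewrite coef_XnM_derivn nth_default ?mul0rn //.
    by rewrite sg.
case/negP: gs; apply/eqP.
pose z := index s Z; have ltz : (z < size Z)%N by rewrite index_mem.
have := congr1 (fun M : 'rV_ _ => M 0 (Ordinal ltz)) vB.
rewrite !mxE => vZ; apply: etrans vZ; rewrite /g coef_sum; apply: eq_bigr => i _.
by rewrite coefZ !mxE /= nth_index.
Qed.

End Wronskian.

(** * Powers and irreducible factors *)

(* [size] may occur at distinct but convertible instances, which [lia] keeps apart. *)
Ltac size_lia :=
  repeat match goal with
  | H : is_true (leq _ _) |- _ =>
      match type of H with context [size] => revert H end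
  end;
  repeat match goal with
  | |- context [size (polyseq ?p)] => move: (size (polyseq p)) => ?
  end; intros; lia.

Ltac size_nia :=
  repeat match goal with
  | H : is_true (leq _ _) |- _ =>
      match type of H with context [size] => revert H end
  end;
  repeat match goal with
  | |- context [size (polyseq ?p)] => move: (size (polyseq p)) => ?
  end; intros; nia.

Section Irreducible.
Variable F : fieldType.
Implicit Types (f g u q : {poly F}).

Lemma irreducible_coprimep u q : irreducible_poly u -> coprimep u q = ~~ (u %| q).
Proof.
move=> [su iu]; apply/idP/idP => [/coprimepP cop|nuq].
  apply/negP => uq; have := cop _ (dvdpp u) uq.
  by rewrite -size_poly_eq1 => /eqP su1; rewrite su1 in su.
rewrite /coprimep; apply: contraNT nuq => /iu/(_ (dvdp_gcdl _ _)) h.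
by rewrite -(eqp_dvdl _ h) dvdp_gcdr.
Qed.

Lemma irreducible_dvdM u f g :
  irreducible_poly u -> ~~ (u %| f) -> ~~ (u %| g) -> ~~ (u %| f * g).
Proof. by move=> iu; rewrite -!irreducible_coprimep // coprimepMr => -> ->. Qed.

Lemma irreducible_dvdX u f n : irreducible_poly u -> ~~ (u %| f) -> ~~ (u %| f ^+ n).
Proof. by move=> iu; rewrite -!irreducible_coprimep // => /coprimep_expr->. Qed.

Lemma multiplicity_exists u f : irreducible_poly u -> f != 0 ->
  exists a q, f = u ^+ a * q /\ ~~ (u %| q).
Proof.
move=> iu; have [k] := ubnP (size f); elim: k f => // k IH f ltf f0.
have [uf|nuf] := boolP (u %| f); last by exists 0%N, f; rewrite mul1r.
have /divpK Ef := uf.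
have q0 : f %/ u != 0 by apply: contra_neq f0 => q0; rewrite -Ef q0 mul0r.
case: (IH (f %/ u)) => // [|a [q [Eq nq]]].
  rewrite size_divp ?irredp_neq0 //; have [su _] := iu.
  have : (0 < size f)%N by rewrite size_poly_gt0.
  size_lia.
by exists a.+1, q; rewrite -Ef Eq exprSr; split=> //; ring.
Qed.

(** A nonconstant such q would itself be irreducible: a nonconstant divisor not associate to q is
    smaller and has no irreducible factor either. *)
Lemma no_irreducible_factor q :
  q != 0 -> (forall u, irreducible_poly u -> u %| q -> False) -> size q = 1%N.
Proof.
move=> q0 nof; apply/eqP; apply: contraT => sq1; exfalso.
have [k] := ubnP (size q); elim: k q q0 nof sq1 => // k IH q q0 nof sq1 ltq.
apply: (nof q) => //; split.
  by rewrite ltn_neqAle eq_sym sq1 size_poly_gt0.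
move=> v sv vq; apply: contraT => nvq; exfalso.
have v0 : v != 0 by apply: contra_neq q0 => v0; apply/eqP; rewrite -dvd0p -v0.
apply: (IH v) => // [u iu uv|]; first exact: nof iu (dvdp_trans uv vq).
have := dvdp_leq q0 vq; rewrite leq_eqVlt => /orP[/eqP Es|lt]; last by size_lia.
by case/negP: nvq; rewrite -dvdp_size_eqp // Es.
Qed.

Lemma dvdp_exp_deriv u n g : u ^+ n %| g -> u ^+ n.-1 %| g^`().
Proof.
case: n => [|n]; first by rewrite !dvd1p.
case/dvdpP => q ->; rewrite derivM deriv_exp /= dvdp_add //.
  by rewrite exprS mulrA dvdp_mull.
by apply: dvdp_mull; rewrite -mulr_natr; apply/dvdp_mulr/dvdp_mull.
Qed.

Lemma dvdp_exp_derivn u n g k : u ^+ n %| g -> u ^+ (n - k) %| g^`(k).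
Proof.
move=> ug; elim: k => [|k IH]; first by rewrite subn0.
by rewrite derivnS subnS; apply: dvdp_exp_deriv.
Qed.

(** The top coefficient of the derivative is the degree of u times its leading coefficient, so the
    derivative is nonzero and too small to be a multiple of u. *)
Lemma irreducible_ndvd_deriv u : irreducible_poly u ->
  ((size u).-1)%:R != 0 :> F -> ~~ (u %| u^`()).
Proof.
move=> iu s0; have [su _] := iu; have u0 := irredp_neq0 iu.
have du0 : u^`() != 0.
  apply: contraTneq (su) => du0; rewrite -leqNgt.
  have := congr1 (fun q : {poly F} => q`_(size u).-2) du0.
  rewrite coef0 coef_deriv prednK; last by rewrite -ltnS prednK // ltnW.
  move/eqP; rewrite -mulr_natr mulf_eq0 (negPf s0) orbF -/(lead_coef u) lead_coef_eq0.
  by rewrite (negPf u0).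
by apply/negP => /(dvdp_leq du0); rewrite leqNgt lt_size_deriv.
Qed.

(** In the cofactor (v+1)u'q + uq' the second summand is a multiple of u and the first is not. *)
Lemma multiplicity_deriv u v q : irreducible_poly u -> ~~ (u %| u^`()) ->
  ~~ (u %| q) -> v.+1%:R != 0 :> F ->
  exists2 q1, (u ^+ v.+1 * q)^`() = u ^+ v * q1 & ~~ (u %| q1).
Proof.
move=> iu nu nq v0; exists (v.+1%:R *: (u^`() * q) + u * q^`()).
  by rewrite derivM deriv_exp /= -mulr_natl -polyC_natr -mul_polyC polyC_natr exprS; ring.
rewrite dvdp_addl ?dvdp_mulr // dvdpZr //; exact: irreducible_dvdM.
Qed.

Lemma multiplicity_derivn u v q k : irreducible_poly u -> ~~ (u %| u^`()) ->
  ~~ (u %| q) -> (k <= v)%N -> (forall i, (0 < i <= v)%N -> i%:R != 0 :> F) ->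
  exists2 q1, (u ^+ v * q)^`(k) = u ^+ (v - k) * q1 & ~~ (u %| q1).
Proof.
move=> iu nu nq + v0; elim: k => [|k IH] lekv.
  by exists q; rewrite ?derivn0 ?subn0.
have [q1 E1 nq1] := IH (ltnW lekv); rewrite derivnS E1.
have -> : (v - k = (v - k.+1).+1)%N by lia.
by apply: multiplicity_deriv => //; apply: v0; lia.
Qed.

Lemma size_exp_upper f a n : (size f <= a.+1)%N -> (size (f ^+ n) <= (n * a).+1)%N.
Proof.
move=> sf; apply: leq_trans (leqSpred _) _; rewrite ltnS size_exp mulnC leq_mul2l.
by rewrite -ltnS (leq_trans (leqSpred _)) ?orbT //; case: (size f) sf.
Qed.

Lemma size_exp_lower u n : (1 < size u)%N -> (n < size (u ^+ n))%N.
Proof.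
move=> su; have u0 : u != 0 by rewrite -size_poly_gt0 ltnW.
rewrite -[size _]prednK ?size_poly_gt0 ?expf_neq0 // ltnS size_exp leq_pmull //.
by rewrite -ltnS prednK // ltnW.
Qed.

Lemma size_det_leq n (A : 'M[{poly F}]_n) B :
  (forall i j, size (A i j) <= B.+1)%N -> (size (\det A) <= (n * B).+1)%N.
Proof.
move=> sA; apply: (leq_trans (size_sum _ _ _)); apply/bigmax_leqP => s _.
rewrite size_Msign; apply: (leq_trans (size_poly_prod_leq _ _)).
have : (\sum_(i < n) size (A i (s i)) <= \sum_(i < n) B.+1)%N by apply: leq_sum.
by rewrite sum_nat_const !card_ord mulnS leq_subLR addnS ltnS.
Qed.

End Irreducible.

(** * Orders of vanishing of d-th powers and of their combinations *)

Section Powers.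
Variables (F : fieldType) (r d delta : nat) (fs : 'I_r -> {poly F}).
Hypothesis le_d : (r.+1 ^ 4 * delta <= d)%N.
Hypothesis fsP : forall i, fs i \is monic /\ (size (fs i) <= delta.+1)%N.
Hypothesis charF : forall n, (0 < n <= d * delta)%N -> n%:R != 0 :> F.

Let fs_neq0 i : fs i != 0. Proof. by apply: monic_neq0; case: (fsP i). Qed.

Lemma size_fs_exp i : (size (fs i ^+ d) <= (d * delta).+1)%N.
Proof. by apply: size_exp_upper; case: (fsP i). Qed.

(** The form in which the bound on d is used: r covers the orders lost by differentiation,
    r(r-1)delta the degree of the determinant in [dvd_combination]. *)
Let lt_rd : (0 < delta -> r + r * (r.-1 * delta) < d)%N.
Proof.
move=> d0; apply: leq_trans le_d; have : (r.+1 ^ 2 <= r.+1 ^ 4)%N by rewrite leq_pexp2l.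
move: (r.+1 ^ 4)%N => R; rewrite expnS expn1 => h.
by case: r h => [|r'] h; nia.
Qed.

Lemma dvd_top_coef (Q : 'I_r.+1 -> {poly F}) i u :
  \sum_k Q k * (fs i ^+ d)^`(k) = 0 -> irreducible_poly u -> u %| fs i ->
  u %| Q ord_max.
Proof.
move=> kill iu ui; apply: contraT => nQ; exfalso.
have [su _] := iu; have su' := dvdp_leq (fs_neq0 i) ui; have [_ sf] := fsP i.
have d0 : (0 < delta)%N by size_lia.
have ltrd := lt_rd d0.
have [a [q [Ef nq]]] := multiplicity_exists iu (fs_neq0 i).
have a0 : (0 < a)%N.
  by case: a Ef => // Ef; case/negP: nq; rewrite -[q]mul1r -(expr0 u) -Ef.
have q0 : q != 0 by apply: contraNneq nq => ->; apply: dvdp0.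
have nu : ~~ (u %| u^`()) 
  by apply: irreducible_ndvd_deriv => //; apply: charF; clear -su su' sf ltrd; size_nia.
have ad : (a <= delta)%N.
  have : u ^+ a %| fs i by rewrite Ef dvdp_mulr.
  move/(dvdp_leq (fs_neq0 i)); have := size_exp_lower a su; size_lia.
have E : fs i ^+ d = u ^+ (a * d) * q ^+ d by rewrite Ef exprMn exprM.
(* The multiplicity is not exhausted, so the r-th derivative lowers it by exactly r, and every
   earlier one keeps one more factor u. *)
have ler : (r <= a * d)%N by clear -a0 ltrd; nia.
have [q1 E1 nq1] : exists2 q1, (fs i ^+ d)^`(r) = u ^+ (a * d - r) * q1 & ~~ (u %| q1).
  rewrite E; apply: multiplicity_derivn => //; first exact: irreducible_dvdX.
  by move=> k hk; apply: charF; clear -hk ad; nia.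
move: kill; rewrite big_ord_recr /= E1 => /eqP; rewrite addr_eq0 => /eqP kill.
have : u ^+ (a * d - r).+1 %| - (Q ord_max * (u ^+ (a * d - r) * q1)).
  rewrite -kill; apply: (big_ind (fun p => _ %| p)) => [|x y|k _].
  - exact: dvdp0.
  - exact: dvdp_add.
  apply: dvdp_mull.
  apply: (@dvdp_trans _ (u ^+ (a * d - k))); first by apply: dvdp_exp2l; have := ltn_ord k; size_lia.
  by apply: dvdp_exp_derivn; rewrite E dvdp_mulr.
rewrite dvdpNr mulrCA mulrC dvdp_exp_sub ?irredp_neq0 // subSnn expr1.
by apply/negP; apply: irreducible_dvdM.
Qed.

Hypothesis indep : independent (fun i => fs i ^+ d).

(* Mason-Stothers in disguise: D kills every power but the i0-th, so a high order of
   vanishing of the combination forces one of f_i0^(d - r + 1) times a determinant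
   whose degree is too small to matter. *)
Lemma dvd_combination u e (c : 'I_r -> F) i0 :
  irreducible_poly u -> (e <= delta)%N -> c i0 != 0 ->
  u ^+ (d * e) %| \sum_i c i *: fs i ^+ d -> u ^+ e %| fs i0.
Proof.
move=> iu; case: e => [|e] led ci0 udvd; first by rewrite dvd1p.
have d0 : (0 < delta)%N by size_lia.
have r0 : (0 < r)%N by have := ltn_ord i0; size_lia.
have ltrd := lt_rd d0.
(* Derivatives of order below r keep the factor [fs i ^+ n]. Thus T is the Wronskian matrix with
   this factor removed from column i, which brings the degrees of its entries down to (r-1)delta. *)
pose n := (d - r.-1)%N.
pose T : 'M[{poly F}]_r := \matrix_(k, i) ((fs i ^+ d)^`(k) %/ fs i ^+ n).
have TE (k : 'I_r) i : (fs i ^+ d)^`(k) = fs i ^+ n * T k i.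
  rewrite mxE mulrC divpK //; apply: (@dvdp_trans _ (fs i ^+ (d - k))).
    by apply: dvdp_exp2l; rewrite /n; have := ltn_ord k; size_lia.
  exact: dvdp_exp_derivn.
have sT k i : (size (T k i) <= (r.-1 * delta).+1)%N.
  rewrite mxE size_divp ?expf_neq0 // size_exp.
  have := size_exp (fs i) d; have [_] := fsP i.
  have : (0 < size (fs i ^+ d))%N by rewrite size_poly_gt0 expf_neq0.
  have : (size ((fs i ^+ d)^`(k)) <= size (fs i ^+ d))%N.
    elim: {TE}(k : nat) => [|j]; first by rewrite derivn0.
    rewrite derivnS; apply: leq_trans.
    by rewrite (leq_trans (size_poly _ _)) // leq_pred.
  rewrite /n; clear -ltrd; size_nia.
(* A left kernel vector would be a nonzero operator of order below r that kills r independent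
   powers. *)
have detT : \det T != 0.
  apply/det0P => -[v v0 vT]; case/negP: v0; apply/eqP/rowP => k; rewrite mxE.
  apply: (wronskian_neq0 (u := fun i => fs i ^+ d) (a := fun k => v 0 k) indep size_fs_exp) => // i.
  have := congr1 (fun M : 'rV_r => fs i ^+ n * M 0 i) vT.
  rewrite !mxE mulr0 mulr_sumr => vTi; apply: etrans vTi; apply: eq_bigr => j _.
  by rewrite TE; ring.
(* Row i0 of the adjugate read as a differential operator: since [\adj T *m T] is scalar, it kills
   all powers but the i0-th. *)
pose D (y : {poly F}) := \sum_(k < r) (\adj T) i0 k * y^`(k).
have DE i : D (fs i ^+ d) = fs i ^+ n * (\det T *+ (i0 == i)).
  transitivity (fs i ^+ n * (\adj T *m T) i0 i); last by rewrite mul_adj_mx !mxE.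
  by rewrite [in RHS]mxE mulr_sumr; apply: eq_bigr => j _; rewrite TE; ring.
have Dg : D (\sum_i c i *: fs i ^+ d) = c i0 *: (fs i0 ^+ n * \det T).
  transitivity (\sum_i c i *: D (fs i ^+ d)).
    rewrite /D (eq_bigr (fun k : 'I_r => \sum_i c i *: ((\adj T) i0 k * (fs i ^+ d)^`(k)))).
      by rewrite exchange_big; apply: eq_bigr => i _; rewrite scaler_sumr.
    move=> k _; rewrite raddf_sum mulr_sumr; apply: eq_bigr => i _.
    by rewrite /= derivnZ scalerAr.
  rewrite (bigD1 i0) //= big1 ?addr0 => [|i ii0].
    by rewrite DE eqxx.
  by rewrite DE eq_sym (negPf ii0) mulr0 scaler0.
(* D has order at most r-1, hence costs at most r-1 factors u. *)
have : u ^+ (d * e.+1 - r.-1) %| fs i0 ^+ n * \det T.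
  rewrite -(dvdpZr _ _ ci0) -Dg; apply: (big_ind (fun p => _ %| p)) => [|x y|k _].
  - exact: dvdp0.
  - exact: dvdp_add.
  apply/dvdp_mull/(@dvdp_trans _ (u ^+ (d * e.+1 - k))).
    by apply: dvdp_exp2l; have := ltn_ord k; size_lia.
  exact: dvdp_exp_derivn.
have [a [q [Ef nq]]] := multiplicity_exists iu (fs_neq0 i0).
rewrite {1}Ef exprMn -exprM => H.
have [lt_ea|le_ae] := ltnP e a; first by rewrite Ef dvdp_mulr // dvdp_exp2l.
(* If a <= e, then [fs i0 ^+ n] absorbs at most d*e factors u; at least d-(r-1) remain to divide the
   determinant, whose degree is smaller. *)
exfalso; move: H; rewrite -mulrA mulrC dvdp_exp_sub ?irredp_neq0 //.
rewrite Gauss_dvdpr; last by apply/coprimep_expl/coprimep_expr; rewrite irreducible_coprimep.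
move/(dvdp_leq detT); have := size_det_leq sT.
have [su _] := iu; have := size_exp_lower (d * e.+1 - r.-1 - a * n) su.
have : (d - r.-1 <= d * e.+1 - r.-1 - a * n)%N.
  have : (a * n <= e * d)%N by rewrite leq_mul // leq_subr.
  rewrite mulnS [(d * e)%N]mulnC; size_lia.
move: (d * e.+1 - r.-1 - a * n)%N => x; clear -ltrd r0; size_lia.
Qed.

End Powers.

(** * The operator L kills the powers *)

Section Operator.
Variables (F : fieldType) (r d : nat) (f : {poly F}) (fs : 'I_r -> {poly F}).

(** Putting [fs i ^+ d] in place of f creates two equal columns; expanding the zero determinant
    along column 0 meets the same minors, since these omit that column. *)
Lemma Wdet_kill i : \sum_(k < r.+1) (-1) ^+ k * Wdet d f fs k * (fs i ^+ d)^`(k) = 0.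
Proof.
pose M := Mmx d (fs i ^+ d) fs.
have : \det M = 0.
  rewrite -det_tr; apply: (determinant_alternate (i1 := ord0) (i2 := lift ord0 i)).
    by rewrite neq_lift.
  by move=> k; rewrite !mxE unlift_none liftK.
rewrite (expand_det_col _ ord0) => det0; apply: etrans det0; apply: eq_bigr => k _.
rewrite /cofactor addn0 !mxE unlift_none mulrC; congr (_ * (_ * _)).
congr (\det _); apply/matrixP => a b; by rewrite !mxE liftK.
Qed.

Lemma Lop_kill i : Lop d f fs (fs i ^+ d) = 0.
Proof.
rewrite /Lop /Qcoef; under eq_bigr => k _ do rewrite -scalerAl.
rewrite -scaler_sumr; apply/eqP; rewrite scaler_eq0; apply/orP; right; apply/eqP.
(* Division by a zero gcd returns 0, so then every [Pcoef] vanishes; otherwise the gcd is cancelled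
   from [Wdet_kill]. *)
have [G0|G0] := eqVneq (Ggcd d f fs) 0.
  by rewrite big1 // => k _; rewrite /Pcoef G0 divp0 mulr0 mul0r.
have dvdG k : Ggcd d f fs %| Wdet d f fs k.
  rewrite /Ggcd; have : k \in index_enum 'I_r.+1 by rewrite mem_index_enum.
  elim: (index_enum _) => // x s IH; rewrite big_cons in_cons => /orP[/eqP->|/IH].
    exact: dvdp_gcdl.
  by apply: dvdp_trans; apply: dvdp_gcdr.
apply: (mulfI G0); rewrite mulr0 mulr_sumr -[RHS](Wdet_kill i); apply: eq_bigr => k _.
rewrite /Pcoef -[in RHS](divpK (dvdG k)); ring.
Qed.

End Operator.

(** * Elimination and counting *)

(** A dependence with [c j] nonzero, solved for the j-th power, would write f with one power fewer;
    [beta] collects the new coefficients. *)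
Lemma minimal_independent (F : fieldType) (r d delta : nat) (f : {poly F})
    (alpha : 'I_r -> F) (fs : 'I_r -> {poly F}) :
  (forall i, size (fs i) <= delta.+1)%N ->
  f = \sum_(i < r) alpha i *: fs i ^+ d -> minimal_representation r d delta f ->
  independent (fun i => fs i ^+ d).
Proof.
case: r alpha fs => [|r] alpha fs sz Ef minf c c0 j; first by case: j.
apply/eqP; apply: contraT => cj; exfalso.
pose beta (k : 'I_r) := alpha (lift j k) - alpha j / c j * c (lift j k).
apply: (minf r beta (fun k => fs (lift j k))) => //.
rewrite Ef; transitivity (\sum_i alpha i *: fs i ^+ d
    - (alpha j / c j) *: \sum_i c i *: fs i ^+ d); first by rewrite c0 scaler0 subr0.
rewrite scaler_sumr -sumrB.
rewrite (bigD1_ord j) //= scalerA divfK // subrr add0r.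
by apply: eq_bigr => k _; rewrite scalerA -scalerBl.
Qed.

Section Elimination.
Variables (F : fieldType) (I : finType).
Implicit Types (w y : I -> {poly F}) (g u P : {poly F}).

(** Elimination creates zero rows, whose coefficients are left free; the number of nonzero rows is
    then the dimension of the span. *)
Definition nz_independent w : Prop :=
  forall c : I -> F, \sum_i c i *: w i = 0 -> forall i, w i != 0 -> c i = 0.

Lemma independent_nz w : independent w -> nz_independent w.
Proof. by move=> indep c /indep c0 i _. Qed.

(** For P = 0 [eliminate] is the identity, so a column without pivot needs no branch in the
    program. *)
Definition pivot w c P : Prop :=
  (P = 0 /\ forall i, (w i)`_c = 0) \/ exists2 q, P = w q & (w q)`_c != 0.

Definition eliminate c P g : {poly F} := g - (g`_c / P`_c) *: P.

Lemma eliminate_sum w c P (a : I -> F) :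
  \sum_i a i *: eliminate c P (w i) = eliminate c P (\sum_i a i *: w i).
Proof.
rewrite /eliminate coef_sum mulr_suml scaler_suml -sumrB; apply: eq_bigr => i _.
by rewrite scalerBr scalerA coefZ mulrA.
Qed.

Lemma coef_eliminate w c P g : pivot w c P -> in_span w g -> (eliminate c P g)`_c = 0.
Proof.
case=> [[-> w0] [a ->]|[q -> wq] _].
  rewrite /eliminate scaler0 subr0 coef_sum big1 // => i _.
  by rewrite coefZ w0 mulr0.
by rewrite /eliminate coefB coefZ divfK // subrr.
Qed.

(** The pivot row is reduced too, to zero, so what remains spans exactly the subspace cut out by the
    vanishing of coefficient c. *)
Lemma eliminate_span w c P : pivot w c P -> forall g,
  in_span (fun i => eliminate c P (w i)) g <-> in_span w g /\ g`_c = 0.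
Proof.
move=> piv g; split=> [[a ->]|[[a ->] g0]].
  rewrite eliminate_sum; split; last by apply: coef_eliminate piv _; exists a.
  case: piv => [[-> _]|[q -> _]].
    by exists a; rewrite /eliminate scaler0 subr0.
  rewrite /eliminate; set s := (_ / _); exists (fun i => a i - (if i == q then s else 0)).
  under [RHS]eq_bigr => i _ do rewrite scalerBl.
  rewrite sumrB; congr (_ - _); rewrite (bigD1 q) //= eqxx big1 ?addr0 // => i iq.
  by rewrite (negPf iq) scale0r.
by exists a; rewrite eliminate_sum /eliminate g0 mul0r scale0r subr0.
Qed.

(** A relation between reduced rows becomes one between the old rows after correcting the
    coefficient of the pivot row, whose own reduction is zero and hence exempt. *)
Lemma eliminate_independent w c P : pivot w c P -> nz_independent w ->
  nz_independent (fun i => eliminate c P (w i)).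
Proof.
move=> piv indep a; rewrite eliminate_sum.
case: piv => [[-> _]|[q -> wq]] Ha i.
  rewrite /eliminate scaler0 subr0 => nz; apply: (indep a) => //.
  by move: Ha; rewrite /eliminate scaler0 subr0.
have [-> | iq] := eqVneq i q; first by rewrite /eliminate divff // scale1r subrr eqxx.
move=> nz; have wi : w i != 0.
  by apply: contra_neq nz => ->; rewrite /eliminate coef0 mul0r scale0r subr0.
move: Ha; rewrite /eliminate; set s := (_ / _) => Ha.
have := indep (fun i => a i - (if i == q then s else 0)) _ _ wi.
rewrite (negPf iq) subr0; apply; rewrite -[RHS]Ha.
under eq_bigr => k _ do rewrite scalerBl.
rewrite sumrB; congr (_ - _); rewrite (bigD1 q) //= eqxx big1 ?addr0 // => k kq.
by rewrite (negPf kq) scale0r.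
Qed.

(* What in-place synthetic division by a monic u leaves in memory: the remainder in
   the low coefficients and the quotient above it. *)
Definition divmap u g : {poly F} := g %/ u * 'X^((size u).-1) + g %% u.

Lemma divmap_sum u w (a : I -> F) :
  \sum_i a i *: divmap u (w i) = divmap u (\sum_i a i *: w i).
Proof.
have divS : (\sum_i a i *: w i) %/ u = \sum_i a i *: (w i %/ u).
  elim/big_rec2: _ => [|i x y _ <-]; first by rewrite div0p.
  by rewrite divpD divpZl.
have modS : (\sum_i a i *: w i) %% u = \sum_i a i *: (w i %% u).
  elim/big_rec2: _ => [|i x y _ <-]; first by rewrite mod0p.
  by rewrite modpD modpZl.
rewrite /divmap divS modS mulr_suml -big_split /=; apply: eq_bigr => i _.
by rewrite scalerDr scalerAl.
Qed.

Lemma divmap_mul u g : u != 0 -> divmap u (g * u) = g * 'X^((size u).-1).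
Proof. by move=> u0; rewrite /divmap mulpK // modp_mull addr0. Qed.

(** Remainder and shifted quotient occupy disjoint ranges of coefficients, so they cannot cancel. *)
Lemma divmap_inj u g : u != 0 -> divmap u g = 0 -> g = 0.
Proof.
move=> u0 Y0; have [|m0] := eqVneq (g %% u) 0.
  move=> m0; have := Y0; rewrite /divmap m0 addr0 => /eqP; rewrite mulf_eq0.
  rewrite expf_eq0 polyX_eq0 andbF orbF => /eqP d0.
  by rewrite (divp_eq g u) m0 d0 mul0r addr0.
have lt : (size (g %% u)%R <= (size u).-1)%N.
  by rewrite -ltnS prednK ?size_poly_gt0 // ltn_modp.
have := congr1 (fun q : {poly F} => q`_(size (g %% u)).-1) Y0.
rewrite coefD coefMXn coef0 ifT ?add0r; last first.
  by apply: leq_trans lt; rewrite prednK // size_poly_gt0.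
by move/eqP; rewrite -/(lead_coef _) lead_coef_eq0 (negPf m0).
Qed.

(** Where the remainder part vanishes, an element of the span is a shifted exact quotient; dropping
    its n low zeros leaves the quotient. *)
Lemma division_step u n w y : u != 0 -> size u = n.+1 -> nz_independent y ->
  (forall g, in_span y g <->
     in_span (fun i => divmap u (w i)) g /\ forall c, (c < n)%N -> g`_c = 0) ->
  nz_independent (fun i => drop_poly n (y i)) /\
  forall g, in_span (fun i => drop_poly n (y i)) g <-> in_span w (g * u).
Proof.
move=> u0 su indep span.
have low i c : (c < n)%N -> (y i)`_c = 0.
  have [|_] := (span (y i)).1; last exact.
  exists (fun k => (k == i)%:R); rewrite (bigD1 i) //= eqxx scale1r big1 ?addr0 // => k ki.
  by rewrite (negPf ki) scale0r.
have yE i : y i = drop_poly n (y i) * 'X^n.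
  rewrite -[LHS](poly_take_drop n) -[RHS]add0r; congr (_ + _).
  by apply/polyP => c; rewrite coef_take_poly coef0; case: ifP => // /low.
have sumE (a : I -> F) : \sum_i a i *: y i = (\sum_i a i *: drop_poly n (y i)) * 'X^n.
  by rewrite mulr_suml; apply: eq_bigr => i _; rewrite -scalerAl -yE.
split=> [a a0 i nz|g].
  apply: (indep a); first by rewrite sumE a0 mul0r.
  by apply: contra_neq nz => ->; rewrite linear0.
transitivity (in_span y (g * 'X^n)).
  split=> [[a ->]|[a Ea]]; exists a; first by rewrite sumE.
  by apply: (mulIf (x := 'X^n)); rewrite ?expf_neq0 ?polyX_eq0 // Ea sumE.
rewrite span; split=> [[[a Ea] _]|[a Ea]].
  exists a; apply/eqP; rewrite -subr_eq0; apply/eqP; apply: (divmap_inj u0).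
  move: Ea; rewrite divmap_sum => Ea.
  have := divmap_mul g u0; rewrite su /= Ea => E.
  rewrite /divmap divpD divpN modpD modpN mulrDl mulNr addrACA -opprD.
  by rewrite -/(divmap u (g * u)) E subrr.
split; first by exists a; rewrite divmap_sum -Ea divmap_mul // su.
by move=> c ltc; rewrite coefMXn ltc.
Qed.

End Elimination.

(** * Products of the given irreducible factors *)

Section Factors.
Variables (F : fieldType) (m : nat) (phi : 'I_m -> {poly F}).
Implicit Type e : nat -> nat.

Definition nphi j : {poly F} := (lead_coef (phi j))^-1 *: phi j.

(** Exponents are functions on all of [nat], so that a row of memory [nmem s 5 i] serves directly as
    [e]. *)
Definition Phi e : {poly F} := \prod_(j < m) nphi j ^+ e j.

Lemma nphi_exp_dvd_Phi e (j : 'I_m) : nphi j ^+ e j %| Phi e.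
Proof. by rewrite /Phi (bigD1 j) //= dvdp_mulr. Qed.

Definition incr e j : nat -> nat := fun j' => (e j' + (j' == j))%N.

Lemma Phi_incr e (j : 'I_m) : Phi (incr e j) = Phi e * nphi j.
Proof.
rewrite /Phi (bigD1 j) //= [in RHS](bigD1 j) //= /incr eqxx addn1 exprSr -!mulrA.
congr (_ * _); rewrite mulrC; congr (_ * _); apply: eq_bigr => i ij.
by rewrite val_eqE (negPf ij) addn0.
Qed.

Hypothesis phi_irr : forall j, irreducible_poly (phi j).
Hypothesis phi_inj : forall i j, phi i %= phi j -> i = j.

Let lc_neq0 j : (lead_coef (phi j))^-1 != 0.
Proof. by rewrite invr_eq0 lead_coef_eq0 irredp_neq0. Qed.

Lemma nphi_monic j : nphi j \is monic.
Proof. by rewrite monicE lead_coefZ mulVf // -invr_eq0. Qed.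

Lemma nphi_eqp j : nphi j %= phi j.
Proof. exact: eqp_scale. Qed.

Lemma nphi_neq0 j : nphi j != 0.
Proof. exact/monic_neq0/nphi_monic. Qed.

Lemma size_nphi j : size (nphi j) = size (phi j).
Proof. exact/eqp_size/nphi_eqp. Qed.

Lemma nphi_irr j : irreducible_poly (nphi j).
Proof.
have [s irr] := phi_irr j; split; first by rewrite size_nphi.
move=> q sq; rewrite (eqp_dvdr _ (nphi_eqp j)) => /(irr q sq) h.
by apply: eqp_trans h _; rewrite eqp_sym nphi_eqp.
Qed.

Lemma nphi_coprime i j : i != j -> coprimep (nphi i) (nphi j).
Proof.
move=> ij; rewrite irreducible_coprimep; last exact: nphi_irr.
rewrite (eqp_dvdl _ (nphi_eqp i)) (eqp_dvdr _ (nphi_eqp j)); apply: contra_neqN ij => dv.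
apply: phi_inj; have [_ irr] := phi_irr j; apply: irr => //.
by have [s _] := phi_irr i; rewrite neq_ltn s orbT.
Qed.

Lemma Phi_monic e : Phi e \is monic.
Proof. by apply: monic_prod => j _; apply/monic_exp/nphi_monic. Qed.

Lemma Phi_neq0 e : Phi e != 0.
Proof. exact/monic_neq0/Phi_monic. Qed.

Lemma nphi_coprime_prod j (s : seq 'I_m) e : j \notin s ->
  coprimep (nphi j) (\prod_(i <- s) nphi i ^+ e i).
Proof.
elim: s => [|i s IH]; first by rewrite big_nil coprimep1.
rewrite in_cons negb_or big_cons coprimepMr => /andP[ji /IH->]; rewrite andbT.
exact/coprimep_expr/nphi_coprime.
Qed.

Lemma dvd_Phi e f : (forall j, nphi j ^+ e j %| f) -> Phi e %| f.
Proof.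
move=> dv; rewrite /Phi; have := index_enum_uniq 'I_m.
elim: (index_enum _) => [|j s IH] /=; first by rewrite big_nil dvd1p.
case/andP=> js us; rewrite big_cons Gauss_dvdp ?dv ?IH //.
exact/coprimep_expl/nphi_coprime_prod.
Qed.

Lemma Phi_dvd_Phi e e' : reflect (forall j : 'I_m, e j <= e' j)%N (Phi e %| Phi e').
Proof.
apply: (iffP idP) => [dv j|le].
  have : nphi j ^+ e j %| Phi e'.
    exact: dvdp_trans (nphi_exp_dvd_Phi e j) dv.
  rewrite /Phi (bigD1 j) //= Gauss_dvdpl.
    by rewrite dvdp_Pexp2l //; case: (nphi_irr j).
  rewrite -big_filter; apply/coprimep_expl/nphi_coprime_prod.
  by rewrite mem_filter eqxx.
apply: dvd_Phi => j; apply: (@dvdp_trans _ (nphi j ^+ e' j)).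
  exact: dvdp_exp2l.
exact: nphi_exp_dvd_Phi.
Qed.

(** An irreducible factor of the cofactor would be associate to some [phi j] and allow raising
    exponent j; so the cofactor is constant and monic. *)
Lemma Phi_maximal e f :
  f \is monic -> (forall u, irreducible_poly u -> u %| f -> exists j, u %= phi j) ->
  Phi e %| f -> (forall j : 'I_m, ~~ (Phi (incr e j) %| f)) -> f = Phi e.
Proof.
move=> monf fac /dvdpP[q Ef] maxe.
have qmon : q \is monic by rewrite -(monicMl _ (Phi_monic e)) mulrC -Ef.
rewrite Ef; suff /eqP : size q = 1%N.
  rewrite size_poly_eq1 eqp_monic ?monic1 // => /eqP->.
  by rewrite mul1r.
apply: no_irreducible_factor; first exact: monic_neq0.
move=> u iu uq; have [|j uj] := fac u iu; first by rewrite Ef dvdp_mulr.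
case/negP: (maxe j); rewrite Phi_incr Ef mulrC dvdp_mul //.
by rewrite (eqp_dvdl _ (nphi_eqp j)) -(eqp_dvdl _ uj).
Qed.

End Factors.

(** * The dimension of the quotient space *)

Section Count.
Variables (F : fieldType) (r d delta m : nat).
Variables (fs h : 'I_r -> {poly F}) (phi : 'I_m -> {poly F}).
Hypothesis phi_irr : forall j, irreducible_poly (phi j).
Hypothesis phi_inj : forall i j, phi i %= phi j -> i = j.
Hypothesis fs_key : forall u e (c : 'I_r -> F) i0,
  irreducible_poly u -> (e <= delta)%N -> c i0 != 0 ->
  u ^+ (d * e) %| \sum_i c i *: fs i ^+ d -> u ^+ e %| fs i0.
Hypothesis indep : independent (fun i => fs i ^+ d).
Hypothesis span : forall g, in_span h g <-> in_span (fun i => fs i ^+ d) g.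

(** The nonzero rows and the quotients f_k^d / Phi_e^d, over k with Phi_e dividing f_k, are two
    independent families, each in the span of the other. *)
Lemma count_nonzero_rows (e : nat -> nat) (w : 'I_r -> {poly F}) :
  (forall j : 'I_m, e j <= delta)%N -> nz_independent w ->
  (forall g, in_span w g <-> in_span h (g * Phi phi e ^+ d)) ->
  #|[pred i | w i != 0]| = #|[pred k | Phi phi e %| fs k]|.
Proof.
move=> le_e nzw spanw; set P := Phi phi e.
have P0 : P ^+ d != 0 by rewrite expf_neq0 // Phi_neq0.
have wE i : exists c : 'I_r -> F, w i = \sum_(k in [pred k | P %| fs k]) c k *: (fs k ^+ d %/ P ^+ d).
  have : in_span w (w i).
    exists (fun k => (k == i)%:R); rewrite (bigD1 i) //= eqxx scale1r big1 ?addr0 // => k ki.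
    by rewrite (negPf ki) scale0r.
  rewrite spanw span => -[c Ec]; exists c; apply: (mulIf P0); rewrite Ec mulr_suml.
  rewrite (bigID [pred k | P %| fs k]) /= [X in _ + X]big1 ?addr0 => [|k nk].
    by apply: eq_bigr => k /= dk; rewrite -scalerAl divpK // dvdp_exp2r.
  (* By [fs_key] at each factor, a power occurring with nonzero coefficient comes from a multiple of
     Phi_e. *)
  have [->|ck] := eqVneq (c k) 0; first by rewrite scale0r.
  case/negP: nk; apply: dvd_Phi => // j; apply: (fs_key (c := c)) => //; first exact: nphi_irr.
  by rewrite -Ec mulnC exprM dvdp_mull // dvdp_exp2r // nphi_exp_dvd_Phi.
apply/eqP; rewrite eqn_leq; apply/andP; split.
  apply: (independent_card_le (u := w) (w := fun k => fs k ^+ d %/ P ^+ d)) => [c c0 i wi|i _].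
    pose c' i := if w i != 0 then c i else 0.
    have <- : c' i = c i by rewrite /c' ifT.
    apply: nzw => //; rewrite -[RHS]c0 [RHS]big_mkcond; apply: eq_bigr => k _.
    by rewrite inE /c'; case: ifP; rewrite ?scale0r.
  exact: wE.
apply: (independent_card_le (u := fun k => fs k ^+ d %/ P ^+ d) (w := w)) => [c c0 k dk|k dk].
  pose c' i := if P %| fs i then c i else 0.
  have <- : c' k = c k by rewrite /c' ifT.
  apply: (indep (c := c')); rewrite -[RHS](mul0r (P ^+ d)) -[X in X * _]c0 mulr_suml.
  rewrite [RHS]big_mkcond; apply: eq_bigr => i _; rewrite inE /c'.
  case: ifP => [di|_]; last by rewrite scale0r.
  by rewrite -scalerAl divpK // dvdp_exp2r.
have : in_span w (fs k ^+ d %/ P ^+ d).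
  rewrite spanw divpK ?dvdp_exp2r // span.
  exists (fun i => (i == k)%:R); rewrite (bigD1 k) //= eqxx scale1r big1 ?addr0 // => i ki.
  by rewrite (negPf ki) scale0r.
case=> c ->; exists c; rewrite [RHS]big_mkcond; apply: eq_bigr => i _.
by rewrite inE; case: eqVneq => //= ->; rewrite scaler0.
Qed.

End Count.

(** * Programs built from bounded loops *)

(* Loops count [v] up to the value of a parameter cell [(a, k, 0)]; when the body
   writes neither [v] nor the parameter arrays, such programs always terminate and
   have a functional semantics. *)
Inductive fprog : Type :=
| PSkip
| PNSet of nat & nexpr & nexpr & nexpr
| PFSet of nat & nexpr & nexpr & fexpr
| PSeq of fprog & fprog
| PIf of bexpr & fprog & fprog
| PFor of nat & nat & nat & fprog.

Notation "# n" := (NConst n) (at level 1, n at level 0, format "# n").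
Notation V v := (NGet v #0 #0).

Definition inc v : cmd := NSet v #0 #0 (NAdd (V v) #1).

Fixpoint compile (p : fprog) : cmd :=
  match p with
  | PSkip => Skip
  | PNSet a i j e => NSet a i j e
  | PFSet a i j e => FSet a i j e
  | PSeq p q => Seq (compile p) (compile q)
  | PIf b p q => If b (compile p) (compile q)
  | PFor v a k p =>
      Seq (NSet v #0 #0 #0)
        (While (NLe (NAdd (V v) #1) (NGet a #k #0)) (Seq (compile p) (inc v)))
  end.

Definition set_var (F : Type) v x (s : state F) : state F :=
  State (upd (nmem s) v 0%N 0%N x) (fmem s).

Fixpoint run (F : fieldType) (p : fprog) (s : state F) : state F :=
  match p with
  | PSkip => s
  | PNSet a i j e => State (upd (nmem s) a (neval s i) (neval s j) (neval s e)) (fmem s)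
  | PFSet a i j e => State (nmem s) (upd (fmem s) a (neval s i) (neval s j) (feval s e))
  | PSeq p q => run q (run p s)
  | PIf b p q => if beval s b then run p s else run q s
  | PFor v a k p =>
      iter (nmem s a k 0%N)
        (fun s => let s' := run p s in set_var v (nmem s' v 0%N 0%N + 1)%N s')
        (set_var v 0%N s)
  end.

Fixpoint nwrites (p : fprog) : seq nat :=
  match p with
  | PNSet a _ _ _ => [:: a]
  | PSeq p q | PIf _ p q => nwrites p ++ nwrites q
  | PFor v _ _ p => v :: nwrites p
  | _ => [::]
  end.

Fixpoint fwrites (p : fprog) : seq nat :=
  match p with
  | PFSet a _ _ _ => [:: a]
  | PSeq p q | PIf _ p q => fwrites p ++ fwrites q
  | PFor _ _ _ p => fwrites p
  | _ => [::]
  end.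

Fixpoint wf (ps : seq nat) (p : fprog) : bool :=
  match p with
  | PNSet a _ _ _ => a \notin ps
  | PSeq p q | PIf _ p q => wf ps p && wf ps q
  | PFor v a _ p => [&& a \in ps, v \notin ps, v \notin nwrites p & wf ps p]
  | _ => true
  end.

(** B bounds all loop limits. In a loop, 14 is 4 for resetting the counter plus 10 for the final
    failing test; 18 is 10 for a test plus 8 for the increment. Both branches of a conditional are
    charged. *)
Fixpoint cost (B : nat) (p : fprog) : nat :=
  match p with
  | PSkip => 1%N
  | PNSet _ i j e => (ncost i + ncost j + ncost e).+1
  | PFSet _ i j e => (ncost i + ncost j + fcost e).+1
  | PSeq p q => (cost B p + cost B q)%N
  | PIf b p q => (bcost b + (cost B p + cost B q)).+1
  | PFor _ _ _ p => (14 + B * (18 + cost B p))%N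
  end.

Section Semantics.
Variable F : fieldType.
Implicit Types (p q : fprog) (s : state F).

Lemma run_seq p q s : run (PSeq p q) s = run q (run p s).
Proof. by []. Qed.

Lemma run_if b p q s : run (PIf b p q) s = if beval s b then run p s else run q s.
Proof. by []. Qed.

Lemma nframe p s a i j : a \notin nwrites p -> nmem (run p s) a i j = nmem s a i j.
Proof.
elim: p s => [|b k l e|b k l e|p IHp q IHq|b p IHp q IHq|v b k p IHp] s //=.
- by rewrite inE /upd => /negPf->.
- by rewrite mem_cat negb_or => /andP[hp hq]; rewrite IHq // IHp.
- by rewrite mem_cat negb_or => /andP[hp hq]; case: ifP; rewrite ?IHq ?IHp.
rewrite in_cons negb_or => /andP[/negPf av hp].
elim: (nmem s b k 0%N) => [|n IH]; first by rewrite /= /upd av.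
by rewrite iterS /= /upd av /= IHp.
Qed.

Lemma fframe p s a i j : a \notin fwrites p -> fmem (run p s) a i j = fmem s a i j.
Proof.
elim: p s => [|b k l e|b k l e|p IHp q IHq|b p IHp q IHq|v b k p IHp] s //=.
- by rewrite inE /upd => /negPf->.
- by rewrite mem_cat negb_or => /andP[hp hq]; rewrite IHq // IHp.
- by rewrite mem_cat negb_or => /andP[hp hq]; case: ifP; rewrite ?IHq ?IHp.
by move=> hp; elim: (nmem s b k 0%N) => [|n IH] //; rewrite iterS /= IHp.
Qed.

Lemma wf_nwrites ps p a : wf ps p -> a \in ps -> a \notin nwrites p.
Proof.
move=> + aps; elim: p => [|b k l e|b k l e|p IHp q IHq|b p IHp q IHq|v b k p IHp] //=.
- by move=> bps; rewrite inE; apply: contraNneq bps => <-.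
- by case/andP=> /IHp hp /IHq hq; rewrite mem_cat negb_or hp.
- by case/andP=> /IHp hp /IHq hq; rewrite mem_cat negb_or hp.
case/and4P=> _ vps _ /IHp hp; rewrite in_cons negb_or hp andbT.
by apply: contraNneq vps => <-.
Qed.

Lemma exec_run ps B p s :
  wf ps p -> (forall a k, a \in ps -> nmem s a k 0%N <= B)%N ->
  exists2 t, exec (compile p) s (run p s) t & (t <= cost B p)%N.
Proof.
elim: p s => [|b k l e|b k l e|p IHp q IHq|b p IHp q IHq|v b k p IHp] s /=.
- by move=> _ _; eexists; first exact: ExecSkip.
- by move=> _ _; eexists; first exact: ExecNSet.
- by move=> _ _; eexists; first exact: ExecFSet.
- case/andP=> wp wq leB; have [t1 e1 l1] := IHp s wp leB.
  have [|t2 e2 l2] := IHq (run p s) wq.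
    by move=> a k ap; rewrite nframe ?leB // (wf_nwrites wp).
  by exists (t1 + t2)%N; [exact: ExecSeq e1 e2 | exact: leq_add].
- case/andP=> wp wq leB; have [t1 e1 l1] := IHp s wp leB.
  have [t2 e2 l2] := IHq s wq leB.
  case: ifP => hb.
    exists (bcost b + t1).+1; first by apply: ExecIf; rewrite hb.
    by rewrite ltnS leq_add2l (leq_trans l1) ?leq_addr.
  exists (bcost b + t2).+1; first by apply: ExecIf; rewrite hb.
  by rewrite ltnS leq_add2l (leq_trans l2) ?leq_addl.
case/and4P=> bps vps vp wp leB.
set n := nmem s b k 0%N; set f := fun s => _; set w := While _ _.
have vb : (b == v) = false by apply: contraNF vps => /eqP <-.
have inv i : (i <= n)%N -> let s' := iter i f (set_var v 0%N s) in
    nmem s' v 0%N 0%N = i /\ forall a k', a \in ps -> nmem s' a k' 0%N = nmem s a k' 0%N.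
  elim: i => [|i IH] lei.
    rewrite /= /upd !eqxx /=; split=> // a k' ap.
    by rewrite (_ : (a == v) = false) //; apply: contraNF vps => /eqP <-.
  have [H1 H2] := IH (ltnW lei); rewrite iterS /f /= /upd !eqxx /=.
  rewrite nframe // H1 addn1; split=> // a k' ap.
  rewrite (_ : (a == v) = false); last by apply: contraNF vps => /eqP <-.
  by rewrite /= nframe ?H2 // (wf_nwrites wp).
(* The induction is on the rounds still to run, because [exec] unfolds a loop at its front and
   [iter] at its back. *)
have loop i : (i <= n)%N -> exists2 t,
    exec w (iter (n - i) f (set_var v 0%N s)) (iter n f (set_var v 0%N s)) t &
    (t <= 10 + i * (18 + cost B p))%N.
  elim: i => [|i IH] lei.
    rewrite subn0; eexists; first apply: ExecWhileF; last by [].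
    have [H1 H2] := inv n (leqnn n).
    by rewrite /= H1 H2 // -/n addn1 ltnn.
  have [t et lt] := IH (ltnW lei).
  have [|H1 H2] := inv (n - i.+1)%N; first exact: leq_subr.
  have [|t1 e1 l1] := IHp (iter (n - i.+1) f (set_var v 0%N s)) wp.
    by move=> a k' ap; rewrite H2 // leB.
  eexists; first apply: ExecWhileT.
  - by rewrite /= H1 H2 // -/n addn1; lia.
  - by apply: ExecSeq; [exact: e1 | exact: ExecNSet].
  - move: et; have -> : (n - i = (n - i.+1).+1)%N by lia.
    by rewrite iterS; apply.
  by rewrite /=; lia.
have [t et lt] := loop n (leqnn n); rewrite subnn in et.
exists (4 + t)%N; first by apply: (ExecSeq (t1 := 4%N) _ et); exact: (@ExecNSet F s v #0 #0 #0).
have : (n <= B)%N by apply: leB.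
nia.
Qed.

(** The degree depends on the syntax alone, one factor linear in B per nested loop, so it is the
    same for all fields and inputs. *)
Lemma cost_poly p : exists K k, forall B, (cost B p <= K * B.+1 ^ k)%N.
Proof.
have le_max K k K' k' B : (K * B.+1 ^ k <= (K + K') * B.+1 ^ (k + k'))%N.
  by apply: leq_mul; rewrite ?leq_addr // leq_pexp2l // leq_addr.
have ge1 B k : (0 < B.+1 ^ k)%N by rewrite expn_gt0.
elim: p => [|b k l e|b k l e|p [K1 [k1 H1]] q [K2 [k2 H2]]|b p [K1 [k1 H1]] q [K2 [k2 H2]]|v b k p [K [l H]]] /=.
- by exists 1%N, 0%N.
- by exists (ncost k + ncost l + ncost e).+1, 0%N => B; rewrite muln1.
- by exists (ncost k + ncost l + fcost e).+1, 0%N => B; rewrite muln1.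
- exists ((K1 + K2) + (K2 + K1))%N, (k1 + k2)%N => B; rewrite mulnDl leq_add //.
    exact: leq_trans (H1 B) (le_max _ _ _ _ _).
  by rewrite [(k1 + k2)%N]addnC; exact: leq_trans (H2 B) (le_max _ _ _ _ _).
- exists (((K1 + K2) + (K2 + K1)) + (bcost b).+1)%N, (k1 + k2)%N => B.
  rewrite -addSn [(_.+1 + _)%N]addnC mulnDl leq_add //; last by rewrite leq_pmulr.
  rewrite mulnDl leq_add //.
    exact: leq_trans (H1 B) (le_max _ _ _ _ _).
  by rewrite [(k1 + k2)%N]addnC; exact: leq_trans (H2 B) (le_max _ _ _ _ _).
exists (32 + K)%N, l.+1 => B; have := H B; have := ge1 B l; rewrite expnS.
move: (cost B p) (B.+1 ^ l)%N => c x; nia.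
Qed.

(** Loop rule. Each round may assume that arrays not written by the loop keep their initial
    contents, so an invariant mentions only what changes. *)
Lemma run_for v a k p s (Inv : nat -> state F -> Prop) :
  v \notin nwrites p ->
  Inv 0%N (set_var v 0%N s) ->
  (forall x s', (x < nmem s a k 0%N)%N -> nmem s' v 0%N 0%N = x ->
     (forall b i j, b \notin v :: nwrites p -> nmem s' b i j = nmem s b i j) ->
     (forall b i j, b \notin fwrites p -> fmem s' b i j = fmem s b i j) ->
     Inv x s' -> Inv x.+1 (set_var v x.+1 (run p s'))) ->
  Inv (nmem s a k 0%N) (run (PFor v a k p) s).
Proof.
move=> vp I0 IS /=; set n := nmem s a k 0%N; set f := fun s => _.
suff H i : (i <= n)%N -> let s' := iter i f (set_var v 0%N s) in
  [/\ Inv i s', nmem s' v 0%N 0%N = i,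
     (forall b i j, b \notin v :: nwrites p -> nmem s' b i j = nmem s b i j) &
     (forall b i j, b \notin fwrites p -> fmem s' b i j = fmem s b i j)].
  by have [] := H n (leqnn n).
elim: i => [|i IH] lei.
  split=> //=; first by rewrite /upd !eqxx.
  by move=> b i j; rewrite in_cons negb_or /upd => /andP[/negPf->].
have [H1 H2 H3 H4] := IH (ltnW lei); rewrite iterS /= /f /=.
rewrite nframe // H2 addn1; split.
- exact: IS.
- by rewrite /= /upd !eqxx.
- move=> b x y hb; rewrite -H3 //; move: hb; rewrite in_cons negb_or => /andP[/negPf bv hb].
  by rewrite /= /upd bv /= nframe.
by move=> b x y hb; rewrite -H4 //= fframe.
Qed.

(** The round may assume that cells not yet reached hold their initial values; this is what in-place
    updates read. *)
Lemma run_for_cells v a k p A s i0 (g : nat -> F) :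
  v \notin nwrites p ->
  (forall x s', (x < nmem s a k 0%N)%N -> nmem s' v 0%N 0%N = x ->
     (forall b i j, b \notin v :: nwrites p -> nmem s' b i j = nmem s b i j) ->
     (forall b i j, b \notin fwrites p -> fmem s' b i j = fmem s b i j) ->
     (forall i j, ~~ ((i == i0) && (j < x)%N) -> fmem s' A i j = fmem s A i j) ->
     forall i j, fmem (run p s') A i j =
       if (i == i0) && (j == x) then g x else fmem s' A i j) ->
  forall i j, fmem (run (PFor v a k p) s) A i j =
    if (i == i0) && (j < nmem s a k 0%N)%N then g j else fmem s A i j.
Proof.
move=> vp body; apply: (run_for (Inv := fun x s' => forall i j, fmem s' A i j =
    if (i == i0) && (j < x)%N then g j else fmem s A i j)) => //.
  by move=> i j; rewrite andbF.
move=> x s' ltx vx hn hf H i j; rewrite /= (body x s') //; last first.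
  by move=> i' j' /negPf hij; rewrite H hij.
rewrite ltnS [(j <= x)%N]leq_eqVlt; case: (eqVneq i i0) => [->|ne] /=.
  case: (eqVneq j x) => [->|nj] //=; by rewrite H eqxx.
by rewrite H (negPf ne).
Qed.

Lemma run_for_rows v a k p A s N (g : nat -> nat -> F) :
  v \notin nwrites p ->
  (forall x s', (x < nmem s a k 0%N)%N -> nmem s' v 0%N 0%N = x ->
     (forall b i j, b \notin v :: nwrites p -> nmem s' b i j = nmem s b i j) ->
     (forall b i j, b \notin fwrites p -> fmem s' b i j = fmem s b i j) ->
     (forall j, fmem s' A x j = fmem s A x j) ->
     (forall i j, i != x -> fmem (run p s') A i j = fmem s' A i j) /\
     (forall j, (j < N)%N -> fmem (run p s') A x j = g x j)) ->
  forall i j, (i < nmem s a k 0%N)%N -> (j < N)%N ->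
    fmem (run (PFor v a k p) s) A i j = g i j.
Proof.
move=> vp body i j lti ltj.
have H : forall i, ((i < nmem s a k 0%N)%N -> forall j, (j < N)%N ->
      fmem (run (PFor v a k p) s) A i j = g i j) /\
    ((nmem s a k 0%N <= i)%N -> forall j, fmem (run (PFor v a k p) s) A i j = fmem s A i j).
  apply: (run_for (Inv := fun x s' => forall i,
    ((i < x)%N -> forall j, (j < N)%N -> fmem s' A i j = g i j) /\
    ((x <= i)%N -> forall j, fmem s' A i j = fmem s A i j))) => //.
  move=> x s' ltx vx hn hf H i'.
  have [|B1 B2] := body x s' ltx vx hn hf; first by have [_] := H x; apply.
  rewrite /=; split=> [|le j']; last first.
    by rewrite B1 ?neq_ltn ?le ?orbT //; have [_ ->] := H i'; rewrite // ltnW.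
  rewrite ltnS leq_eqVlt => /orP[/eqP->|lt] j' ltj'; first exact: B2.
  by rewrite B1 ?neq_ltn ?lt //; have [H1 _] := H i'; apply: H1.
by have [H1 _] := H i; apply: H1.
Qed.

End Semantics.

Arguments run : simpl never.

(** * The algorithm *)

Definition FSub e1 e2 : fexpr := FAdd e1 (FOpp e2).

(* Loop counters: 10 = i (row being searched), 11 = j, 12 = t, 13 = factor index,
   14 and 15 = the delta- and d-fold repetitions, 16 = row, 17 and 18 = columns,
   19 = pivot candidate, 20 = row already found.  Scalars: 6 = number of columns,
   21 = dimension, 22 and 24 = flags, 23 = number of dominating rows.
   Natural array 5 holds the exponents; field array 3 holds the working rows,
   4 the pivot row, 5 an accumulator. *)
Definition deg_phi : nexpr := NSub (NGet 2 (V 13) #0) #1.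
(** Counters only increase; this makes counter 18 scan the columns from the last one down. *)
Definition rcol : nexpr := NSub (NSub (V 6) #1) (V 18).
Definition Wcell i j : fexpr := FGet 3 i j.
Definition nphi_coef x : fexpr := FMul (FInv (FGet 1 (V 13) deg_phi)) (FGet 1 (V 13) x).

Definition load_prog : fprog :=
  PFor 16 0 0 (PFor 17 6 0 (PFSet 3 (V 16) (V 17) (FGet 0 (V 16) (V 17)))).

Definition div_prog : fprog :=
  PFor 16 0 0 (PFor 18 6 0 (PIf (NLe deg_phi rcol)
    (PFor 17 6 0
       (PIf (BAnd (NLe (NSub rcol deg_phi) (V 17)) (NLe (NAdd (V 17) #1) rcol))
          (PFSet 3 (V 16) (V 17)
             (FSub (Wcell (V 16) (V 17))
                (FMul (Wcell (V 16) rcol) (nphi_coef (NSub (V 17) (NSub rcol deg_phi))))))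
          PSkip))
    PSkip)).

(** The pivot is copied aside because reduction annihilates the pivot row itself. The last candidate
    wins; with none, the copy stays zero. *)
Definition pivot_prog : fprog :=
  PSeq (PFor 17 6 0 (PFSet 4 #0 (V 17) FZero))
    (PFor 19 0 0 (PIf (FEq (Wcell (V 19) (V 18)) FZero) PSkip
       (PFor 17 6 0 (PFSet 4 #0 (V 17) (Wcell (V 19) (V 17)))))).

(** The multiplier is stored first, since the row's cell in the pivot column is overwritten on the
    way. *)
Definition reduce_prog : fprog :=
  PFor 16 0 0
    (PSeq (PFSet 5 #0 #0 (FMul (Wcell (V 16) (V 18)) (FInv (FGet 4 #0 (V 18)))))
       (PFor 17 6 0 (PFSet 3 (V 16) (V 17)
          (FSub (Wcell (V 16) (V 17)) (FMul (FGet 5 #0 #0) (FGet 4 #0 (V 17))))))).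

Definition elim_prog : fprog :=
  PFor 18 6 0 (PIf (NLe (NAdd (V 18) #1) deg_phi) (PSeq pivot_prog reduce_prog) PSkip).

Definition shift_prog : fprog :=
  PFor 16 0 0 (PFor 17 6 0
    (PIf (NLe (NAdd (NAdd (V 17) deg_phi) #1) (V 6))
       (PFSet 3 (V 16) (V 17) (Wcell (V 16) (NAdd (V 17) deg_phi)))
       (PFSet 3 (V 16) (V 17) FZero))).

Definition step_prog : fprog := PSeq div_prog (PSeq elim_prog shift_prog).

(* Runs [p] exactly [d * e_j] times for each factor j, e being row i of the exponents. *)
Definition repeat_prog (p : fprog) : fprog :=
  PFor 13 0 3 (PFor 14 0 2 (PFor 15 0 1
    (PIf (NLe (NAdd (V 14) #1) (NGet 5 (V 10) (V 13))) p PSkip))).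

Definition count_prog : fprog :=
  PSeq (PNSet 21 #0 #0 #0)
    (PFor 16 0 0 (PSeq (PNSet 22 #0 #0 #0)
       (PSeq (PFor 17 6 0 (PIf (FEq (Wcell (V 16) (V 17)) FZero) PSkip (PNSet 22 #0 #0 #1)))
          (PNSet 21 #0 #0 (NAdd (V 21) (V 22)))))).

(** Domination of exponents is divisibility, by [Phi_dvd_Phi], so no polynomial arithmetic is needed
    to count the known multiples. *)
Definition found_prog : fprog :=
  PSeq (PNSet 23 #0 #0 #0)
    (PFor 20 0 0 (PIf (NLe (NAdd (V 20) #1) (V 10))
       (PSeq (PNSet 24 #0 #0 #1)
          (PSeq (PFor 13 0 3 (PIf (NLe (NGet 5 (V 10) (V 13)) (NGet 5 (V 20) (V 13)))
                   PSkip (PNSet 24 #0 #0 #0)))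
             (PNSet 23 #0 #0 (NAdd (V 23) (V 24)))))
       PSkip)).

Definition test_prog : fprog :=
  PSeq load_prog (PSeq (repeat_prog step_prog) (PSeq count_prog found_prog)).

Definition try_prog : fprog :=
  PSeq (PNSet 5 (V 10) (V 11) (NAdd (NGet 5 (V 10) (V 11)) #1))
    (PSeq test_prog
       (PIf (NLe (V 21) (V 23))
          (PNSet 5 (V 10) (V 11) (NSub (NGet 5 (V 10) (V 11)) #1)) PSkip)).

(** The product is formed in place from the top down: its coefficient of degree c needs old
    coefficients of degree at most c, none overwritten so far. *)
Definition mul_prog : fprog :=
  PFor 18 6 0 (PSeq (PFSet 5 #0 #0 FZero)
    (PSeq (PFor 17 6 0 (PIf (NLe (V 17) rcol)
             (PFSet 5 #0 #0 (FAdd (FGet 5 #0 #0)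
                (FMul (FGet 2 (V 10) (NSub rcol (V 17))) (nphi_coef (V 17))))) PSkip))
       (PFSet 2 (V 10) rcol (FGet 5 #0 #0)))).

Definition out_prog : fprog :=
  PSeq (PFor 17 6 0 (PIf (NEq (V 17) #0) (PFSet 2 (V 10) (V 17) FOne)
                                          (PFSet 2 (V 10) (V 17) FZero)))
    (PSeq (repeat_prog mul_prog) (PNSet 4 (V 10) #0 (V 6))).

Definition main_prog : fprog :=
  PSeq (PFor 10 0 0 (PSeq (PFor 11 0 3 (PFor 12 0 2 try_prog)) out_prog))
    (PNSet 3 #0 #0 (NGet 0 #0 #0)).

(** The width d*delta + 1 comes from repeated addition, the model having no multiplication of
    naturals. It is computed separately because [main_prog] uses array 6 as a read-only loop
    limit. *)
Definition width_prog : fprog :=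
  PSeq (PNSet 6 #0 #0 #1) (PFor 12 0 2 (PNSet 6 #0 #0 (NAdd (V 6) (NGet 0 #1 #0)))).

Definition algorithm : cmd := Seq (compile width_prog) (compile main_prog).

Lemma wf_width : wf [:: 0%N] width_prog. Proof. by []. Qed.
Lemma wf_main : wf [:: 0%N; 6] main_prog. Proof. by []. Qed.

(** * In-place synthetic division *)

Section Synthetic.
Variables (F : fieldType) (N n : nat) (u : {poly F}).
Hypothesis mon_u : u \is monic.
Hypothesis size_u : size u = n.+1.

(** Subtracting without the top term of u leaves coefficient c in place, where it is the next
    coefficient of the quotient. *)
Fixpoint synth t (g : {poly F}) : {poly F} :=
  if t is t'.+1 then
    let y := synth t' g in let c := (N - 1 - t')%N in
    if (n <= c)%N then y - y`_c *: ((u - 'X^n) * 'X^(c - n)) else y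
  else g.

Lemma coef_top : u`_n = 1.
Proof. by move/monicP: mon_u; rewrite /lead_coef size_u. Qed.

Lemma coef_synth_term c x : (n <= c)%N ->
  ((u - 'X^n) * 'X^(c - n))`_x =
  if (c - n <= x)%N && (x < c)%N then u`_(x - (c - n)) else 0.
Proof.
move=> le_nc; rewrite coefMXn ltnNge; case: (leqP (c - n) x) => //= le; rewrite coefB coefXn.
have [lt|ge] := ltnP x c.
  by rewrite (_ : (_ == n) = false) ?subr0 //; lia.
have [->|ne] := eqVneq x c.
  have -> : (c - (c - n) = n)%N by lia.
  by rewrite eqxx coef_top subrr.
rewrite nth_default ?size_u; last by lia.
by rewrite (_ : (_ == n) = false) ?subr0 //; lia.
Qed.

Lemma synth_divmap (g : {poly F}) : (size g <= N)%N -> synth N g = divmap u g.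
Proof.
move=> sg.
(* Q is the quotient found so far: g - Q*u is cleared from degree max(n, N-t) upwards, and Q is
   still zero at the positions to come. *)
have inv t : (t <= N)%N -> exists Q : {poly F}, [/\ synth t g = g - Q * (u - 'X^n),
    (size (synth t g - Q * 'X^n)%R <= maxn n (N - t))%N &
    forall x, (x + n < N - t)%N -> Q`_x = 0].
  elim: t => [|t IH] let_.
    by exists 0; rewrite !mul0r !subr0 subn0 /= leq_max sg orbT; split=> // x _; rewrite coef0.
  have [Q [EQ sQ lowQ]] := IH (ltnW let_); rewrite /=.
  set y := synth t g in EQ sQ *; set c := (N - 1 - t)%N.
  have Nt : (N - t = c.+1)%N by rewrite /c; lia.
  have Nt1 : (N - t.+1 = c)%N by rewrite /c; lia.
  rewrite Nt in sQ lowQ; rewrite Nt1.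
  case: ifP => [le_nc|/negbT]; last rewrite -ltnNge => lt_cn; last first.
    exists Q; split=> //; last by move=> x hx; apply: lowQ; lia.
    by move: sQ; rewrite (maxn_idPl lt_cn) (maxn_idPl (ltnW lt_cn)).
  exists (Q + y`_c *: 'X^(c - n)); split.
  - by rewrite {1}EQ -!mul_polyC; ring.
  - move: sQ; rewrite (maxn_idPr le_nc) (maxn_idPr (leqW le_nc)) => sQ.
    have -> : y - y`_c *: ((u - 'X^n) * 'X^(c - n)) - (Q + y`_c *: 'X^(c - n)) * 'X^n
      = (y - Q * 'X^n) - y`_c *: (u * 'X^(c - n)).
      by rewrite -!mul_polyC; ring.
    apply/leq_sizeP => x; rewrite leq_eqVlt => /orP[/eqP<-|lt].
      rewrite coefB coefZ coefMXn ltnNge leq_subr /=.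
      have -> : (c - (c - n) = n)%N by lia.
      rewrite coef_top coefB coefMXn ltnNge le_nc /= lowQ; last by lia.
      by rewrite subr0 mulr1 subrr.
    rewrite coefB nth_default ?(leq_trans sQ) // coefZ coefMXn ltnNge.
    rewrite (leq_trans _ (ltnW lt)) ?leq_subr //=.
    by rewrite [u`__]nth_default ?mulr0 ?subr0 // size_u; lia.
  - move=> x hx; rewrite coefD lowQ ?coefZ ?coefXn; last by lia.
    by rewrite (_ : (_ == _) = false) ?mulr0 ?addr0 //; lia.
have [Q [EQ sQ _]] := inv N (leqnn N); rewrite subnn maxn0 in sQ.
have [] := @divp_modpP _ g Q u (synth N g - Q * 'X^n).
- by rewrite EQ; ring.
- by rewrite size_u ltnS.
by move=> EQd Er; rewrite /divmap -EQd -Er size_u /=; ring.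
Qed.

End Synthetic.

(** * Correctness of the subprograms *)

Section Subprograms.
Variables (F : fieldType) (r d delta m N : nat).
Variables (h : 'I_r -> {poly F}) (phi : 'I_m -> {poly F}).
Hypothesis phi_irr : forall j, irreducible_poly (phi j).
Implicit Types (s : state F) (w : nat -> {poly F}) (j : 'I_m).

Definition inputs s : Prop :=
  [/\ [/\ nmem s 0 0 0 = r, nmem s 0 1 0 = d, nmem s 0 2 0 = delta & nmem s 0 3 0 = m],
      nmem s 6 0 0 = N,
      forall j, nmem s 2 j 0 = size (phi j),
      forall (i : 'I_r) x, fmem s 0 i x = (h i)`_x
    & forall j x, fmem s 1 j x = (phi j)`_x].

Lemma inputs_agree s s' (nw fw : seq nat) :
  all [pred b | b \notin nw] [:: 0%N; 2; 6] -> all [pred b | b \notin fw] [:: 0%N; 1%N] ->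
  (forall b i k, b \notin nw -> nmem s' b i k = nmem s b i k) ->
  (forall b i k, b \notin fw -> fmem s' b i k = fmem s b i k) ->
  inputs s -> inputs s'.
Proof.
move=> /and4P[n0 n2 n6 _] /and3P[f0 f1 _] Hn Hf [[H1 H2 H3 H4] H5 H6 H7 H8].
split; first by split; rewrite Hn.
- by rewrite Hn.
- by move=> j; rewrite Hn.
- by move=> i x; rewrite Hf.
- by move=> j x; rewrite Hf.
Qed.

Lemma inputs_run p s :
  all [pred b | b \notin nwrites p] [:: 0%N; 2; 6] ->
  all [pred b | b \notin fwrites p] [:: 0%N; 1%N] -> inputs s -> inputs (run p s).
Proof.
by move=> hn hf; apply: inputs_agree hn hf _ _ => b i k hb; [apply: nframe|apply: fframe].
Qed.

Definition rows s w : Prop :=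
  forall a x, (a < r)%N -> (x < N)%N -> fmem s 3 a x = (w a)`_x.

Definition bounded w : Prop := forall a, (a < r)%N -> (size (w a) <= N)%N.

Lemma rows_agree s s' w :
  (forall i k, fmem s' 3 i k = fmem s 3 i k) -> rows s w -> rows s' w.
Proof. by move=> H rw a x la lx; rewrite H rw. Qed.

Lemma deg_phiE s j : inputs s -> nmem s 13 0 0 = j ->
  neval s deg_phi = (size (phi j)).-1.
Proof. by move=> [_ _ H _ _] hj; rewrite /deg_phi /= hj H subn1. Qed.

Lemma size_nphi_deg j : size (nphi phi j) = (size (phi j)).-1.+1.
Proof. by rewrite size_nphi // prednK // size_poly_gt0 irredp_neq0. Qed.

Lemma nphi_coefE s j x : inputs s -> nmem s 13 0 0 = j ->
  feval s (nphi_coef x) = (nphi phi j)`_(neval s x).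
Proof.
move=> cs hj; have [_ _ Hs _ H1] := cs.
by rewrite /nphi_coef /deg_phi /= hj Hs !H1 subn1 /nphi coefZ.
Qed.

Lemma rcolE s : inputs s -> neval s rcol = (N - 1 - nmem s 18 0 0)%N.
Proof. by case=> _ H _ _ _; rewrite /rcol /= H. Qed.

Opaque deg_phi rcol nphi_coef.

Lemma load_spec s : inputs s -> rows (run load_prog s) (family_at 0 h id).
Proof.
move=> cs a x la lx; have [[Hr _ _ _] HN _ _ _] := cs.
apply: (@run_for_rows F 16%N 0%N 0%N _ 3%N s N (fun a x => (family_at 0 h id a)`_x)); rewrite ?Hr //.
move=> i s' li hi hn hf _.
have cs' : inputs s' by apply: inputs_agree hn hf cs.
have [_ HN' _ H0 _] := cs'.
have E : forall i' x', fmem (run (PFor 17 6 0 (PFSet 3 (V 16) (V 17) (FGet 0 (V 16) (V 17)))) s') 3 i' x'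
   = if (i' == i) && (x' < N)%N then (family_at 0 h id i)`_x' else fmem s' 3 i' x'.
  rewrite -HN'; apply: run_for_cells => // k s'' lk hk hn' hf' _ i' x'.
  rewrite /run /= /upd /= hk hn' // hi hf' //.
  have lir : (i < r)%N by move: li; rewrite ?Hr.
  by case: ifP => // _; rewrite /family_at insubT; apply: (H0 (Ordinal lir)).
by split=> [i' x' /negPf ne|x' lx']; rewrite E ?ne // eqxx lx'.
Qed.

Lemma div_spec s w j : inputs s -> nmem s 13 0 0 = j -> rows s w -> bounded w ->
  rows (run div_prog s) (fun a => divmap (nphi phi j) (w a)).
Proof.
move=> cs hj rw bw a x la lx; have [[Hr _ _ _] HN _ _ _] := cs.
set u := nphi phi j; set n := (size (phi j)).-1.
have mu : u \is monic by apply: nphi_monic.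
have su : size u = n.+1 by apply: size_nphi_deg.
rewrite -(synth_divmap mu su (bw a la)).
apply: (@run_for_rows F 16%N 0%N 0%N _ 3%N s N (fun a x => (synth N n u N (w a))`_x)); rewrite ?Hr //.
move=> i s' li hi hn hf hrow.
have cs' : inputs s' by apply: inputs_agree hn hf cs.
have hj' : nmem s' 13 0 0 = j by rewrite hn.
have [_ HN' _ _ _] := cs'.
rewrite -[X in synth _ _ _ X]HN'.
apply: (run_for (Inv := fun t s'' =>
  (forall i' x', i' != i -> fmem s'' 3 i' x' = fmem s' 3 i' x') /\
  (forall x', (x' < N)%N -> fmem s'' 3 i x' = (synth N n u t (w i))`_x'))) => //.
  by split=> // x' lx'; rewrite /= hrow rw.
move=> t s'' lt ht hn' hf' [I1 I2].
have cs'' : inputs s'' by apply: inputs_agree hn' hf' cs'.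
have hj'' : nmem s'' 13 0 0 = j by rewrite hn'.
have hi'' : nmem s'' 16 0 0 = i by rewrite hn'.
rewrite run_if /= (deg_phiE cs'' hj'') (rcolE cs'') ht -/n.
have [_ HN'' _ _ _] := cs''.
set c := (N - 1 - t)%N; case: ifP => [le_nc|_]; last by [].
set p := PFor 17 6 0 _.
have E : forall i' x', fmem (run p s'') 3 i' x'
   = if (i' == i) && (x' < nmem s'' 6 0 0)%N then
       (synth N n u t (w i) - (synth N n u t (w i))`_c *: ((u - 'X^n) * 'X^(c - n)))`_x'
     else fmem s'' 3 i' x'.
  apply: run_for_cells => // k s3 lk hk hn3 hf3 hcell i' x'.
  have cs3 : inputs s3 by apply: inputs_agree hn3 hf3 cs''.
  have hj3 : nmem s3 13 0 0 = j by rewrite hn3.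
  have hi3 : nmem s3 16 0 0 = i by rewrite hn3.
  have hd3 := deg_phiE cs3 hj3; have hr3 := rcolE cs3.
  rewrite (hn3 18%N) // ht -/c in hr3.
  rewrite coefB coefZ (coef_synth_term mu su) // run_if.
  have -> : beval s3 (BAnd (NLe (NSub rcol deg_phi) (V 17)) (NLe (NAdd (V 17) #1) rcol))
     = (c - n <= k)%N && (k < c)%N.
    by rewrite /= hd3 hr3 hk addn1.
  have lkN : (k < N)%N by rewrite -HN''.
  have Wk : fmem s3 3 i k = (synth N n u t (w i))`_k.
    by rewrite hcell ?ltnn ?andbF // I2.
  case: ifP => [/andP[le1 lt2]|_]; last first.
    rewrite /run mulr0 subr0; case: ifP => // /andP[/eqP-> /eqP->].
    by rewrite Wk.
  rewrite /run /= /upd /= (nphi_coefE _ cs3 hj3) /= hk hi3 hr3 hd3.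
  case: ifP => // _; rewrite Wk; congr (_ - _ * _).
  (* Column c still holds the multiplier: only columns below k have been written, and k < c. *)
  by rewrite hcell ?I2 // ?eqxx /c -?leqNgt; lia.
split=> [i' x' ne|x' lx'].
  by rewrite [fmem _]/= E (negPf ne) I1.
by rewrite [fmem _]/= E HN'' eqxx lx'.
Qed.

Lemma pivot_spec s w c : inputs s -> nmem s 18 0 0 = c -> (c < N)%N ->
  rows s w -> bounded w ->
  exists P : {poly F}, [/\ forall x, (x < N)%N -> fmem (run pivot_prog s) 4 0 x = P`_x,
    (size P <= N)%N & pivot (fun i : 'I_r => w i) c P].
Proof.
move=> cs hc lc rw bw; rewrite /pivot_prog run_seq; set p0 := PFor 17 6 0 (PFSet 4 _ _ FZero).
have [[Hr _ _ _] HN _ _ _] := cs.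
have E0 x : (x < N)%N -> fmem (run p0 s) 4 0 x = 0.
  move=> lx; rewrite (@run_for_cells F 17%N 6%N 0%N _ 4%N s 0%N (fun=> 0)) ?HN ?lx //.
  by move=> k s' lk hk _ _ _ i j; rewrite /run /= /upd /= hk.
set s1 := run p0 s.
have cs1 : inputs s1 by apply: inputs_run.
have rw1 : rows s1 w by apply: rows_agree rw => i k; apply: fframe.
have hc1 : nmem s1 18 0 0 = c by rewrite nframe.
have {cs} [[Hr1 _ _ _] HN1 _ _ _] := cs1.
have [P [HP sP]] : exists P : {poly F},
   [/\ forall x, (x < N)%N -> fmem (run (PFor 19 0 0 (PIf (FEq (Wcell (V 19) (V 18)) FZero) PSkip
       (PFor 17 6 0 (PFSet 4 #0 (V 17) (Wcell (V 19) (V 17)))))) s1) 4 0 x = P`_x,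
    (size P <= N)%N &
    (P = 0 /\ forall i, (i < nmem s1 0 0 0)%N -> (w i)`_c = 0) \/
     exists2 q, (q < r)%N & P = w q /\ (w q)`_c != 0].
  apply: (run_for (Inv := fun t s' => exists P : {poly F},
   [/\ forall x, (x < N)%N -> fmem s' 4 0 x = P`_x,
    (size P <= N)%N &
    (P = 0 /\ forall i, (i < t)%N -> (w i)`_c = 0) \/
     exists2 q, (q < r)%N & P = w q /\ (w q)`_c != 0])) => //.
    by exists 0; rewrite size_poly0; split=> //; [move=> x lx; rewrite /= E0 // coef0|left].
  move=> q s' lq hq hn hf [P [HP sP cP]]; rewrite Hr1 in lq.
  have cs' : inputs s' by apply: inputs_agree hn hf cs1.
  have [_ HN' _ _ _] := cs'.
  have hc' : nmem s' 18 0 0 = c by rewrite hn.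
  have rw' : rows s' w by apply: rows_agree rw1 => i k; apply: hf.
  rewrite run_if /= hq hc' rw' //; case: eqP => [wq0|/eqP wq0].
    exists P; split=> //; case: cP => [[P0 Pi]|]; [left|by right].
    by split=> // i; rewrite ltnS leq_eqVlt => /orP[/eqP->|/Pi].
  exists (w q); split; [|exact: bw|by right; exists q].
  move=> x lx; rewrite (@run_for_cells F 17%N 6%N 0%N _ 4%N s' 0%N (fun x => (w q)`_x)) ?HN' ?lx //.
  move=> k s2 lk hk hn2 hf2 _ i j; rewrite /run /= /upd /= hk hn2 // hq hf2 // rw' //.
rewrite Hr1 => cP; exists P; split=> //.
case: cP => [[P0 Pi]|[q lq [-> wq]]]; first by left; split=> // i; apply: Pi.
by right; exists (Ordinal lq).
Qed.

Lemma reduce_spec s w c (P : {poly F}) : inputs s -> nmem s 18 0 0 = c -> (c < N)%N ->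
  rows s w -> (forall x, (x < N)%N -> fmem s 4 0 x = P`_x) ->
  rows (run reduce_prog s) (fun a => eliminate c P (w a)).
Proof.
move=> cs hc lc rw HP a x la lx; have [[Hr _ _ _] HN _ _ _] := cs.
apply: (@run_for_rows F 16%N 0%N 0%N _ 3%N s N (fun a x => (eliminate c P (w a))`_x)); rewrite ?Hr //.
move=> i s' li hi hn hf hrow; rewrite ?Hr in li.
have hc' : nmem s' 18 0 0 = c by rewrite hn.
have hP' y : (y < N)%N -> fmem s' 4 0 y = P`_y by move=> ly; rewrite hf // HP.
have hW' y : (y < N)%N -> fmem s' 3 i y = (w i)`_y by move=> ly; rewrite hrow rw.
rewrite run_seq; set s1 := run (PFSet _ _ _ _) s'.
have n1 b k l : nmem s1 b k l = nmem s' b k l by apply: nframe.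
have f1 b k l : b != 5%N -> fmem s1 b k l = fmem s' b k l by move=> hb; apply: fframe; rewrite inE.
have T1 : fmem s1 5 0 0 = (w i)`_c / P`_c.
  by rewrite /s1 /run /= /upd /= hi hc' hW' // hP'.
have E : forall i' x', fmem (run (PFor 17 6 0 (PFSet 3 (V 16) (V 17)
          (FSub (Wcell (V 16) (V 17)) (FMul (FGet 5 #0 #0) (FGet 4 #0 (V 17)))))) s1) 3 i' x'
   = if (i' == i) && (x' < nmem s1 6 0 0)%N then (eliminate c P (w i))`_x' else fmem s1 3 i' x'.
  apply: run_for_cells => // k s2 lk hk hn2 hf2 hcell i' x'.
  have lkN : (k < N)%N by move: lk; rewrite n1 hn // HN.
  rewrite /run /= /upd /= hk hn2 // n1 hi (hf2 5%N) // T1 (hf2 4%N) // f1 // hP' //.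
  rewrite hcell ?ltnn ?andbF // f1 // hW' //.
  by rewrite /eliminate coefB coefZ.
have HN1 : nmem s1 6 0 0 = N by rewrite n1 hn.
split=> [i' x' ne|x' lx']; first by rewrite E (negPf ne) f1.
by rewrite E eqxx HN1 lx'.
Qed.

Lemma span_bounded w g : bounded w -> in_span (fun i : 'I_r => w i) g -> (size g <= N)%N.
Proof.
move=> bw [c ->]; apply: (leq_trans (size_sum _ _ _)); apply/bigmax_leqP => k _.
exact: leq_trans (size_scale_leq _ _) (bw k (ltn_ord k)).
Qed.

Lemma elim_spec s w j : inputs s -> nmem s 13 0 0 = j -> rows s w -> bounded w ->
  nz_independent (fun i : 'I_r => w i) ->
  exists y : nat -> {poly F}, [/\ rows (run elim_prog s) y, bounded y,
    nz_independent (fun i : 'I_r => y i) &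
    forall g, in_span (fun i : 'I_r => y i) g <-> in_span (fun i : 'I_r => w i) g /\
      forall c, (c < (size (phi j)).-1)%N -> g`_c = 0].
Proof.
move=> cs hj rw bw indep; have [_ HN _ _ _] := cs; set n := (size (phi j)).-1.
have : exists y : nat -> {poly F}, [/\ rows (run elim_prog s) y, bounded y,
    nz_independent (fun i : 'I_r => y i) &
    forall g, in_span (fun i : 'I_r => y i) g <-> in_span (fun i : 'I_r => w i) g /\
      forall c, (c < nmem s 6 0 0)%N -> (c < n)%N -> g`_c = 0].
  apply: (run_for (Inv := fun t s' => exists y : nat -> {poly F}, [/\ rows s' y, bounded y,
    nz_independent (fun i : 'I_r => y i) &
    forall g, in_span (fun i : 'I_r => y i) g <-> in_span (fun i : 'I_r => w i) g /\
      forall c, (c < t)%N -> (c < n)%N -> g`_c = 0])) => //.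
    by exists w; split=> // g; split=> [|[]].
  move=> c s' lc hc hn hf [y [ry bry iy sy]]; rewrite HN in lc.
  have cs' : inputs s' by apply: inputs_agree hn hf cs.
  have hj' : nmem s' 13 0 0 = j by rewrite hn.
  rewrite run_if /= (deg_phiE cs' hj') -/n hc addn1; case: ifP => lcn; last first.
    exists y; split=> // g; rewrite sy; split=> -[sg g0]; split=> // c' lc' lc'n; apply: g0 => //.
      by move: lc'; rewrite ltnS leq_eqVlt => /orP[/eqP E|//]; rewrite E lcn in lc'n.
    by rewrite ltnS ltnW.
  have [P [HP sP piv]] := pivot_spec cs' hc lc ry bry.
  rewrite run_seq; set s1 := run pivot_prog s'.
  have cs1 : inputs s1 by apply: inputs_run.
  have hc1 : nmem s1 18 0 0 = c by rewrite nframe.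
  have ry1 : rows s1 y by apply: rows_agree ry => i k; apply: fframe.
  exists (fun a => eliminate c P (y a)); split.
  - exact: (reduce_spec cs1 hc1 lc ry1 HP).
  - move=> a la; apply: (leq_trans (size_polyD _ _)); rewrite geq_max bry //= size_polyN.
    exact: leq_trans (size_scale_leq _ _) sP.
  - exact: eliminate_independent piv iy.
  - move=> g; rewrite (eliminate_span piv) sy; split=> [[[sg g0] gc]|[sg g0]].
      split=> // c' ; rewrite ltnS leq_eqVlt => /orP[/eqP-> //|]; exact: g0.
    by split; [split=> // c' lc' ; apply: g0; rewrite ltnS ltnW|apply: g0].
case=> y [ry bry iy sy]; exists y; split=> // g; rewrite sy HN.
split=> -[sg g0]; split=> // c lc; last by apply: g0.
(* The loop stops at column N even if the factor has larger degree; coefficients beyond vanish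
   because the rows have size at most N. *)
have [lcN|leN] := ltnP c N; first exact: g0.
by rewrite nth_default // (leq_trans (span_bounded bw sg)).
Qed.

Lemma shift_spec s w j : inputs s -> nmem s 13 0 0 = j -> rows s w -> bounded w ->
  rows (run shift_prog s) (fun a => drop_poly (size (phi j)).-1 (w a)).
Proof.
move=> cs hj rw bw a x la lx; have [[Hr _ _ _] HN _ _ _] := cs; set n := (size (phi j)).-1.
apply: (@run_for_rows F 16%N 0%N 0%N _ 3%N s N (fun a x => (drop_poly n (w a))`_x)); rewrite ?Hr //.
move=> i s' li hi hn hf hrow; rewrite ?Hr in li.
have cs' : inputs s' by apply: inputs_agree hn hf cs.
have hj' : nmem s' 13 0 0 = j by rewrite hn.
have [_ HN' _ _ _] := cs'.
set p := PFor _ _ _ _.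
have E : forall i' x', fmem (run p s') 3 i' x'
   = if (i' == i) && (x' < nmem s' 6 0 0)%N then (drop_poly n (w i))`_x' else fmem s' 3 i' x'.
  apply: run_for_cells => // k s2 lk hk hn2 hf2 hcell i' x'.
  have cs2 : inputs s2 by apply: inputs_agree hn2 hf2 cs'.
  have hj2 : nmem s2 13 0 0 = j by rewrite hn2.
  have hi2 : nmem s2 16 0 0 = i by rewrite hn2.
  have [_ HN2 _ _ _] := cs2.
  rewrite run_if /= (deg_phiE cs2 hj2) -/n hk HN2 addn1 coef_drop_poly; case: ltnP => lkn.
    rewrite /run /= /upd /= (deg_phiE cs2 hj2) -/n hk hi2 hcell; last by rewrite eqxx /= -leqNgt leq_addr.
    by rewrite hrow rw.
  by rewrite /run /= /upd /= hk hi2 [_`_(k + n)]nth_default // (leq_trans (bw i li)).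
split=> [i' x' ne|x' lx']; first by rewrite E (negPf ne).
by rewrite E eqxx HN' lx'.
Qed.

Lemma step_spec s w j : inputs s -> nmem s 13 0 0 = j -> rows s w -> bounded w ->
  nz_independent (fun i : 'I_r => w i) ->
  exists y : nat -> {poly F}, [/\ rows (run step_prog s) y, bounded y,
    nz_independent (fun i : 'I_r => y i) &
    forall g, in_span (fun i : 'I_r => y i) g <->
              in_span (fun i : 'I_r => w i) (g * nphi phi j)].
Proof.
move=> cs hj rw bw indep; rewrite /step_prog !run_seq; set u := nphi phi j.
have u0 : u != 0 by apply: nphi_neq0.
have su := size_nphi_deg j.
have r1 := div_spec cs hj rw bw; set s1 := run div_prog s in r1 *.
have cs1 : inputs s1 by apply: inputs_run.
have hj1 : nmem s1 13 0 0 = j by rewrite nframe.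
(* Division in place widens no row: neither the shifted quotient nor the remainder is longer than
   the dividend. *)
have b1 : bounded (fun a => divmap u (w a)).
  move=> a la; have wa := bw a la; apply: (leq_trans (size_polyD _ _)); rewrite geq_max.
  have [wu|uw] := ltnP (size (w a)) (size u).
    by rewrite divp_small // mul0r size_poly0 /= modp_small.
  apply/andP; split; last by rewrite (leq_trans (ltnW (ltn_modpN0 _ u0))) // (leq_trans uw).
  have [->|q0] := eqVneq (w a %/ u) 0; first by rewrite mul0r size_poly0.
  rewrite size_mulXn // size_divp //; apply: leq_trans wa.
  by rewrite subnKC // (leq_trans (leq_pred _)).
have i1 : nz_independent (fun i : 'I_r => divmap u (w i)).
  move=> c; rewrite divmap_sum => /(divmap_inj u0) c0 i nz; apply: (indep c) => //.
  by apply: contra_neq nz => ->; rewrite /divmap div0p mod0p mul0r addr0.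
have [y [ry bry iy sy]] := elim_spec cs1 hj1 r1 b1 i1.
set s2 := run elim_prog s1 in ry *.
have cs2 : inputs s2 by apply: inputs_run.
have hj2 : nmem s2 13 0 0 = j by rewrite nframe.
have r3 := shift_spec cs2 hj2 ry bry.
have [i3 sp3] := division_step (w := fun i : 'I_r => w i) u0 su iy sy.
eexists; split; [exact: r3| |exact: i3|exact: sp3].
by move=> a la; rewrite size_drop_poly (leq_trans (leq_subr _ _)) // bry.
Qed.

End Subprograms.

(** * Repetition, counting and output *)

Section Search.
Variables (F : fieldType) (r d delta m N : nat).
Variables (h : 'I_r -> {poly F}) (phi : 'I_m -> {poly F}).
Implicit Types (s : state F) (w : nat -> {poly F}) (e : nat -> nat).

Local Notation inputs := (inputs d delta N h phi).
Local Notation rows := (rows r N).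
Local Notation bounded := (bounded r N).
Local Notation Phi := (Phi phi).
Local Notation nphi := (nphi phi).

Opaque deg_phi rcol nphi_coef.

(** [J q] describes the state once the factors collected in q are processed; it depends on the field
    memory only, as counters change around p. It serves both the divisions and the final
    multiplications. *)
Lemma repeat_spec p (J : {poly F} -> state F -> Prop) s e i :
  all [pred b | b \notin nwrites p] [:: 0%N; 2; 5; 6; 10; 13; 14; 15] ->
  all [pred b | b \notin fwrites p] [:: 0%N; 1%N] ->
  (forall q s1 s2, (forall b k l, fmem s2 b k l = fmem s1 b k l) -> J q s1 -> J q s2) ->
  (forall q s' (j : 'I_m), inputs s' -> nmem s' 13 0 0 = j -> nmem s' 10 0 0 = i ->
     J q s' -> J (q * nphi j) (run p s')) ->
  inputs s -> nmem s 10 0 0 = i ->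
  (forall j : 'I_m, nmem s 5 i j = e j /\ (e j <= delta)%N) ->
  J 1 s -> J (Phi e ^+ d) (run (repeat_prog p) s).
Proof.
move=> Hn Hf Jagree Jstep cs hi he J1.
have [n0 [n2 [n5 [n6 [n10 [n13 [n14 n15]]]]]]] : 0%N \notin nwrites p /\ 2 \notin nwrites p /\
    5 \notin nwrites p /\ 6 \notin nwrites p /\ 10 \notin nwrites p /\ 13 \notin nwrites p /\
    14 \notin nwrites p /\ 15 \notin nwrites p.
  by move: Hn; rewrite /= => /and5P[-> -> -> -> /and5P[-> -> -> -> _]].
have [[Hr Hd HD Hm] _ _ _ _] := cs.
have -> : Phi e ^+ d = \prod_(j < m | (j < nmem s 0 3 0)%N) nphi j ^+ (d * e j).
  rewrite /Phi -prodrXl; apply: eq_big => [j|j _]; first by rewrite Hm ltn_ord.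
  by rewrite mulnC exprM.
apply: (run_for (Inv := fun t s' => J (\prod_(j < m | (j < t)%N) nphi j ^+ (d * e j)) s')).
- by rewrite /= cats0 !inE n13.
- by rewrite big_pred0_eq; apply: Jagree J1.
rewrite Hm => jj s1 lj hj1 hn1 hf1 Js1; pose j : 'I_m := Ordinal lj.
have A1 b : b \in [:: 0%N; 2; 5; 6; 10] -> b \notin [:: 13, 14, 15 & nwrites p ++ [::]].
  rewrite !inE cats0 => /or4P[|||/orP[]] /eqP->; by rewrite /= ?n0 ?n2 ?n5 ?n6 ?n10.
have cs1 : inputs s1.
  apply: inputs_agree hn1 hf1 cs; first by rewrite /= !A1.
  by move: Hf; rewrite /= cats0.
have hi1 : nmem s1 10 0 0 = i by rewrite hn1 ?A1.
have he1 (k : 'I_m) : nmem s1 5 i k = e k by rewrite hn1 ?A1 //; case: (he k).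
have [[_ Hd1 HD1 _] _ _ _ _] := cs1.
have -> : \prod_(k < m | (k < jj.+1)%N) nphi k ^+ (d * e k) =
   (\prod_(k < m | (k < jj)%N) nphi k ^+ (d * e k)) * nphi j ^+ (d * minn (nmem s1 0 2 0) (e j)).
  have -> : minn (nmem s1 0 2 0) (e j) = e j by rewrite HD1; apply/minn_idPr; case: (he j).
  rewrite (bigD1 j) //= mulrC; congr (_ * _); apply: eq_bigl => k.
  by rewrite -val_eqE /=; lia.
set Q := \prod_(k < m | (k < jj)%N) _ in Js1 *.
pose body := PIf (NLe (NAdd (V 14) #1) (NGet 5 (V 10) (V 13))) p PSkip.
apply: (Jagree _ (run (PFor 14 0 2 (PFor 15 0 1 body)) s1)) => //.
  (* The loop always makes delta rounds, of which those with a < e_j act; hence the minimum. *)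
  apply: (run_for (Inv := fun a s' => J (Q * nphi j ^+ (d * minn a (e j))) s')).
  - by rewrite /= cats0 inE n14.
  - by rewrite min0n muln0 mulr1; apply: Jagree Js1.
  move=> a s2 la ha hn2 hf2 Js2.
  have A2 b : b \in [:: 0%N; 2; 5; 6; 10; 13] -> b \notin [:: 14, 15 & nwrites p ++ [::]].
    rewrite !inE cats0 => /or4P[|||/or3P[]] /eqP->; by rewrite /= ?n0 ?n2 ?n5 ?n6 ?n10 ?n13.
  have cs2 : inputs s2.
    apply: inputs_agree hn2 hf2 cs1; first by rewrite /= !A2.
    by move: Hf; rewrite /= cats0.
  have hi2 : nmem s2 10 0 0 = i by rewrite hn2 ?A2.
  have hj2 : nmem s2 13 0 0 = j by rewrite hn2 ?A2.
  have he2 (k : 'I_m) : nmem s2 5 i k = e k by rewrite hn2 ?A2.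
  have [[_ Hd2 HD2 _] _ _ _ _] := cs2.
  have -> : Q * nphi j ^+ (d * minn a.+1 (e j)) =
      Q * nphi j ^+ (d * minn a (e j)) * nphi j ^+ (nmem s2 0 1 0 * (a < e j)%N).
    rewrite -mulrA -exprD Hd2 -mulnDr; congr (_ * _ ^+ (_ * _)).
    by case: (ltnP a (e j)); lia.
  set Q2 := Q * _ in Js2 *.
  apply: (Jagree _ (run (PFor 15 0 1 body) s2)) => //.
    apply: (run_for (Inv := fun b s' => J (Q2 * nphi j ^+ (b * (a < e j)%N)) s')).
    - by rewrite /= cats0.
    - by rewrite mul0n mulr1; apply: Jagree Js2.
    move=> b s3 lb hb hn3 hf3 Js3.
    have A3 b' : b' \in [:: 0%N; 2; 5; 6; 10; 13; 14] -> b' \notin 15 :: nwrites p ++ [::].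
      rewrite !inE cats0 => /or4P[|||/or4P[]] /eqP->; by rewrite /= ?n0 ?n2 ?n5 ?n6 ?n10 ?n13 ?n14.
    have cs3 : inputs s3.
      apply: inputs_agree hn3 hf3 cs2; first by rewrite /= !A3.
      by move: Hf; rewrite /= cats0.
    have hi3 : nmem s3 10 0 0 = i by rewrite hn3 ?A3.
    have hj3 : nmem s3 13 0 0 = j by rewrite hn3 ?A3.
    have ha3 : nmem s3 14 0 0 = a by rewrite hn3 ?A3.
    have he3 (k : 'I_m) : nmem s3 5 i k = e k by rewrite hn3 ?A3.
    rewrite run_if [beval _ _]/= hi3 hj3 ha3 he3 addn1.
    case: ifP => lt_ae; rewrite lt_ae in Js3.
      apply: (Jagree _ (run p s3)) => //.
      by rewrite !muln1 in Js3 *; rewrite exprSr mulrA; apply: Jstep.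
    by apply: (Jagree _ s3) => //; rewrite muln0 in Js3; rewrite muln0.
Qed.

Lemma count_spec s w : inputs s -> rows s w -> bounded w ->
  nmem (run count_prog s) 21 0 0 = #|[pred i : 'I_r | w i != 0]|.
Proof.
move=> cs rw bw; rewrite /count_prog run_seq; set s1 := run _ s.
have cs1 : inputs s1 by apply: inputs_run.
have rw1 : rows s1 w by apply: rows_agree rw => i k; apply: fframe.
have [[Hr _ _ _] HN _ _ _] := cs1.
have -> : #|[pred i : 'I_r | w i != 0]| = (\sum_(i < r) (w i != 0%R))%N.
  by rewrite -sum1_card big_mkcond; apply: eq_bigr => i _; rewrite inE; case: ifP.
rewrite -Hr.
apply: (run_for (Inv := fun t s' => nmem s' 21 0 0 = \sum_(i < t) (w i != 0%R))%N) => //.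
  by rewrite big_ord0.
rewrite Hr => a s2 la ha hn2 hf2 I2; rewrite !run_seq big_ord_recr -I2 /=.
have cs2 : inputs s2 by apply: inputs_agree hn2 hf2 cs1.
have rw2 : rows s2 w by apply: rows_agree rw1 => i k; apply: hf2.
set s3 := run (PNSet 22 _ _ _) s2.
have cs3 : inputs s3 by apply: inputs_run.
have rw3 : rows s3 w by apply: rows_agree rw2 => i k; apply: fframe.
have ha3 : nmem s3 16 0 0 = a by rewrite nframe.
have h21 : nmem s3 21 0 0 = nmem s2 21 0 0 by rewrite nframe.
have [_ HN3 _ _ _] := cs3.
set p := PFor 17 6 0 _.
have E : nmem (run p s3) 22 0 0 = has (fun x => (w a)`_x != 0) (iota 0 (nmem s3 6 0 0)).
  apply: (run_for (Inv := fun t s' => nmem s' 22 0 0 = has (fun x => (w a)`_x != 0) (iota 0 t) :> nat)) => //.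
  move=> x s4 lx hx hn4 hf4 I4.
  have rw4 : rows s4 w by apply: rows_agree rw3 => i k; apply: hf4.
  have ha4 : nmem s4 16 0 0 = a by rewrite hn4.
  have -> : iota 0 x.+1 = rcons (iota 0 x) x by rewrite -addn1 iotaD cats1.
  rewrite HN3 in lx; rewrite run_if has_rcons /= hx ha4 rw4 //.
  by case: eqP => wx; rewrite /= /upd /=.
have -> : (w a != 0) = has (fun x => (w a)`_x != 0) (iota 0 N).
  apply/idP/hasP => [wa|[x _ wx]]; last by apply: contra_neq wx => ->; rewrite coef0.
  exists (size (w a)).-1; last by rewrite -/(lead_coef _) lead_coef_eq0.
  by rewrite mem_iota /= add0n prednK ?size_poly_gt0 // bw.
rewrite HN3 in E; rewrite /run -/run /= /upd /= E; congr (_ + _)%N.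
by rewrite -h21; apply: nframe.
Qed.

Lemma found_spec s i : inputs s -> nmem s 10 0 0 = i -> (i <= r)%N ->
  nmem (run found_prog s) 23 0 0 =
    (\sum_(k < i) [forall j : 'I_m, (nmem s 5 i j <= nmem s 5 k j)%N])%N.
Proof.
move=> cs hi leir; rewrite /found_prog run_seq; set s1 := run _ s.
have cs1 : inputs s1 by apply: inputs_run.
have hi1 : nmem s1 10 0 0 = i by rewrite nframe.
have E1 k j : nmem s1 5 k j = nmem s 5 k j by rewrite nframe.
have [[Hr _ _ _] _ _ _ _] := cs1.
have -> : (\sum_(k < i) [forall j : 'I_m, (nmem s 5 i j <= nmem s 5 k j)%N] =
   \sum_(k < nmem s1 0 0 0) ((k < i) && [forall j : 'I_m, nmem s 5 i j <= nmem s 5 k j]))%N.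
  rewrite Hr (big_ord_widen r (fun k => nat_of_bool [forall j : 'I_m, nmem s 5 i j <= nmem s 5 k j]%N)) //.
  by rewrite big_mkcond; apply: eq_bigr => k _; case: (k < i)%N.
apply: (run_for (Inv := fun t s' => nmem s' 23 0 0 =
   \sum_(k < t) ((k < i) && [forall j : 'I_m, nmem s 5 i j <= nmem s 5 k j]))%N) => //.
  by rewrite big_ord0.
move=> k s2 lk hk hn2 hf2 I2; rewrite big_ord_recr -I2 /=.
have cs2 : inputs s2 by apply: inputs_agree hn2 hf2 cs1.
have hi2 : nmem s2 10 0 0 = i by rewrite hn2.
rewrite run_if /= hk hi2 addn1; case: ifP => lki; last by rewrite /= addn0.
rewrite !run_seq; set s3 := run (PNSet 24 _ _ _) s2.
have cs3 : inputs s3 by apply: inputs_run.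
have hi3 : nmem s3 10 0 0 = i by rewrite nframe.
have hk3 : nmem s3 20 0 0 = k by rewrite nframe.
have h23 : nmem s3 23 0 0 = nmem s2 23 0 0 by rewrite nframe.
have E3 a b : nmem s3 5 a b = nmem s 5 a b by rewrite nframe // hn2.
have [[_ _ _ Hm] _ _ _ _] := cs3.
set p := PFor 13 0 3 _.
have E : nmem (run p s3) 24 0 0 =
    all (fun j => nmem s 5 i j <= nmem s 5 k j)%N (iota 0 (nmem s3 0 3 0)).
  apply: (run_for (Inv := fun t s' => nmem s' 24 0 0 =
    all (fun j => nmem s 5 i j <= nmem s 5 k j)%N (iota 0 t) :> nat)) => //.
  move=> x s4 lx hx hn4 hf4 I4.
  have hi4 : nmem s4 10 0 0 = i by rewrite hn4.
  have hk4 : nmem s4 20 0 0 = k by rewrite hn4.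
  have -> : iota 0 x.+1 = rcons (iota 0 x) x by rewrite -addn1 iotaD cats1.
  by rewrite run_if all_rcons /= hx hi4 hk4 !(hn4 5%N) // !E3; case: ifP.
have -> : [forall j : 'I_m, (nmem s 5 i j <= nmem s 5 k j)%N] =
    all (fun j => nmem s 5 i j <= nmem s 5 k j)%N (iota 0 m).
  apply/forallP/allP => [H x|H j]; last by apply: H; rewrite mem_iota ltn_ord.
  by rewrite mem_iota /= add0n => lx; apply: (H (Ordinal lx)).
rewrite Hm in E; rewrite /run -/run /= /upd /= E; congr (_ + _)%N.
by rewrite -h23; apply: nframe.
Qed.

Lemma mul_spec s i (j : 'I_m) (q : {poly F}) :
  inputs s -> nmem s 13 0 0 = j -> nmem s 10 0 0 = i ->
  (forall x, (x < N)%N -> fmem s 2 i x = q`_x) ->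
  (forall k x, k != i -> fmem (run mul_prog s) 2 k x = fmem s 2 k x) /\
  (forall x, (x < N)%N -> fmem (run mul_prog s) 2 i x = (q * nphi j)`_x).
Proof.
move=> cs hj hi Hq; have [_ HN _ _ _] := cs; set u := nphi j.
have : (forall k x, k != i -> fmem (run mul_prog s) 2 k x = fmem s 2 k x) /\
  (forall x, (x < N)%N -> fmem (run mul_prog s) 2 i x =
     if (N - nmem s 6 0 0 <= x)%N then (q * u)`_x else q`_x).
  apply: (run_for (Inv := fun t s' =>
    (forall k x, k != i -> fmem s' 2 k x = fmem s 2 k x) /\
    (forall x, (x < N)%N -> fmem s' 2 i x = if (N - t <= x)%N then (q * u)`_x else q`_x))) => //.
    by split=> // x lx; rewrite /= Hq // subn0 leqNgt lx.
  rewrite HN => t s1 lt ht hn1 hf1 [I1 I2]; rewrite !run_seq.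
  have cs1 : inputs s1 by apply: inputs_agree hn1 hf1 cs.
  set c := (N - 1 - t)%N; have lcN : (c < N)%N by rewrite /c; lia.
  set s2 := run (PFSet _ _ _ _) s1.
  have cs2 : inputs s2 by apply: inputs_run.
  have n2 b k l : nmem s2 b k l = nmem s1 b k l by apply: nframe.
  have f2 k l : fmem s2 2 k l = fmem s1 2 k l by apply: fframe.
  have [_ HN2 _ _ _] := cs2.
  set p := PFor 17 6 0 _.
  have E : fmem (run p s2) 5 0 0 = \sum_(b < nmem s2 6 0 0 | (b < c.+1)%N) q`_(c - b) * u`_b.
    apply: (run_for (Inv := fun x s' => fmem s' 5 0 0 =
       \sum_(b < x | (b < c.+1)%N) q`_(c - b) * u`_b)) => //.
      by rewrite big_ord0 /s2 /run /= /upd.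
    move=> x s3 lx hx hn3 hf3 I3.
    have cs3 : inputs s3 by apply: inputs_agree hn3 hf3 cs2.
    have hj3 : nmem s3 13 0 0 = j by rewrite hn3 // n2 hn1.
    have hi3 : nmem s3 10 0 0 = i by rewrite hn3 // n2 hn1.
    have h18 : nmem s3 18 0 0 = t by rewrite hn3 // n2.
    have hr3 := rcolE cs3; rewrite h18 -/c in hr3.
    rewrite run_if /= hr3 hx big_mkcond big_ord_recr -big_mkcond /= -I3 ltnS.
    case: ifP => lexc; last by rewrite addr0.
    rewrite /run /= /upd /= (nphi_coefE _ cs3 hj3) /= hr3 hx hi3 (hf3 2%N) // f2 I2; last by lia.
    by rewrite ifF //; lia.
  rewrite HN2 -(big_ord_widen N (fun b => q`_(c - b) * u`_b)) // -coefMr in E.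
  set s4 := run p s2 in E *.
  have cs4 : inputs s4 by apply: inputs_run.
  have h18 : nmem s4 18 0 0 = t by rewrite nframe // n2.
  have hi4 : nmem s4 10 0 0 = i by rewrite nframe // n2 hn1.
  have hr4 := rcolE cs4; rewrite h18 -/c in hr4.
  have f4 k l : fmem s4 2 k l = fmem s1 2 k l by rewrite fframe.
  rewrite /run -/run /= /upd /=; split=> [k x ne|x lx].
    by rewrite hi4 (negPf ne) /= f4 I1.
  rewrite hi4 eqxx hr4 E f4 I2 //=; case: (eqVneq x c) => [->|ne].
    by rewrite ifT //; rewrite /c; lia.
  by congr (if _ then _ else _); move: ne; rewrite /c; lia.
by case=> H1 H2; split=> // x lx; rewrite H2 // HN subnn.
Qed.

Lemma out_spec s i e : inputs s -> nmem s 10 0 0 = i ->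
  (forall j : 'I_m, nmem s 5 i j = e j /\ (e j <= delta)%N) ->
  [/\ (forall k x, k != i -> fmem (run out_prog s) 2 k x = fmem s 2 k x),
      (forall x, (x < N)%N -> fmem (run out_prog s) 2 i x = (Phi e ^+ d)`_x),
      (forall k x, k != i -> nmem (run out_prog s) 4 k x = nmem s 4 k x)
    & nmem (run out_prog s) 4 i 0 = N].
Proof.
move=> cs hi he; rewrite /out_prog !run_seq; set p0 := PFor 17 6 0 _.
have [_ HN _ _ _] := cs.
have E0 : forall k x, fmem (run p0 s) 2 k x =
    if (k == i) && (x < nmem s 6 0 0)%N then (1 : {poly F})`_x else fmem s 2 k x.
  apply: run_for_cells => // x s1 lx hx hn1 _ _ k y.
  have hi1 : nmem s1 10 0 0 = i by rewrite hn1.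
  by rewrite run_if /= hx coef1; case: (eqVneq x 0%N) => _; rewrite /run /= /upd /= hx hi1.
set s1 := run p0 s in E0 *.
have cs1 : inputs s1 by apply: inputs_run.
have hi1 : nmem s1 10 0 0 = i by rewrite nframe.
have he1 j : nmem s1 5 i j = nmem s 5 i j by rewrite nframe.
have [J1 J2] : (forall k x, k != i -> fmem (run (repeat_prog mul_prog) s1) 2 k x = fmem s 2 k x) /\
   (forall x, (x < N)%N -> fmem (run (repeat_prog mul_prog) s1) 2 i x = (Phi e ^+ d)`_x).
  apply: (repeat_spec (J := fun q s' => (forall k x, k != i -> fmem s' 2 k x = fmem s 2 k x) /\
   (forall x, (x < N)%N -> fmem s' 2 i x = q`_x)) (s := s1) (i := i)) => //.
  - by move=> q sa sb H [H1 H2]; split=> [k x ne|x lx]; rewrite H; [apply: H1|apply: H2].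
  - move=> q s2 j cs2 hj2 hi2 [H1 H2].
    have [M1 M2] := mul_spec cs2 hj2 hi2 H2; split=> // k x ne.
    by rewrite M1 ?H1.
  - by move=> j; rewrite he1.
  - by split=> [k x ne|x lx]; rewrite E0 ?(negPf ne) // HN eqxx lx.
set s2 := run _ s1 in J1 J2 *.
have cs2 : inputs s2 by apply: inputs_run.
have hi2 : nmem s2 10 0 0 = i by rewrite nframe.
have h4 k x : nmem s2 4 k x = nmem s 4 k x by rewrite !nframe.
have [_ HN2 _ _ _] := cs2.
rewrite /run -/run /= /upd /= hi2 HN2; split=> // [k x ne|]; last by rewrite eqxx.
by rewrite (negPf ne) h4.
Qed.

End Search.

(** * The search *)

Section Main.
Variables (F : fieldType) (r d delta m N : nat).
Variables (fs h : 'I_r -> {poly F}) (phi : 'I_m -> {poly F}).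
Hypothesis phi_irr : forall j, irreducible_poly (phi j).
Hypothesis phi_inj : forall i j, phi i %= phi j -> i = j.
Hypothesis fsP : forall k, fs k \is monic /\ (size (fs k) <= delta.+1)%N.
Hypothesis fs_factors : forall k u,
  irreducible_poly u -> u %| fs k -> exists j, u %= phi j.
Hypothesis fs_key : forall u e (c : 'I_r -> F) i0,
  irreducible_poly u -> (e <= delta)%N -> c i0 != 0 ->
  u ^+ (d * e) %| \sum_i c i *: fs i ^+ d -> u ^+ e %| fs i0.
Hypothesis indep : independent (fun i => fs i ^+ d).
Hypothesis h_indep : independent h.
Hypothesis span : forall g, in_span h g <-> in_span (fun i => fs i ^+ d) g.
Hypothesis h_size : forall i, (size (h i) <= N)%N.
Hypothesis fs_size : forall i, (size (fs i ^+ d) <= N)%N.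
Implicit Types (s : state F) (e : nat -> nat) (ks : seq 'I_r).

Local Notation inputs := (inputs d delta N h phi).
Local Notation Phi := (Phi phi).

Lemma Phi_ext e e' : (forall j : 'I_m, e j = e' j) -> Phi e = Phi e'.
Proof. by move=> E; apply: eq_bigr => j _; rewrite E. Qed.

Lemma family_at_ord (i : 'I_r) : family_at 0 h id i = h i.
Proof.
rewrite /family_at insubT //= => lti; congr (h _); exact: val_inj.
Qed.

Lemma test_spec s i e : inputs s -> nmem s 10 0 0 = i -> (i <= r)%N ->
  (forall j : 'I_m, nmem s 5 i j = e j /\ (e j <= delta)%N) ->
  nmem (run test_prog s) 21 0 0 = #|[pred k | Phi e %| fs k]| /\
  nmem (run test_prog s) 23 0 0 =
    (\sum_(k < i) [forall j : 'I_m, (nmem s 5 i j <= nmem s 5 k j)%N])%N.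
Proof.
move=> cs hi leir he; rewrite /test_prog 3!run_seq.
set s1 := run load_prog s.
have cs1 : inputs s1 by apply: inputs_run.
have hi1 : nmem s1 10 0 0 = i by rewrite nframe.
have he1 (j : 'I_m) : nmem s1 5 i j = e j /\ (e j <= delta)%N by rewrite nframe.
set s2 := run (repeat_prog step_prog) s1.
have cs2 : inputs s2 by apply: inputs_run.
have hE : forall w : nat -> {poly F}, (forall i : 'I_r, w i = h i) ->
    forall g, in_span (fun i : 'I_r => w i) g <-> in_span h g.
  by move=> w E g; split=> -[c Ec]; exists c; rewrite Ec; apply: eq_bigr => k _; rewrite E.
have [w [rw bw iw sw]] : exists w : nat -> {poly F}, [/\ rows r N s2 w, bounded r N w,
    nz_independent (fun i : 'I_r => w i) &
    forall g, in_span (fun i : 'I_r => w i) g <-> in_span h (g * Phi e ^+ d)].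
  apply: (repeat_spec (J := fun q s => exists w : nat -> {poly F}, [/\ rows r N s w, bounded r N w,
    nz_independent (fun i : 'I_r => w i) &
    forall g, in_span (fun i : 'I_r => w i) g <-> in_span h (g * q)]) _ _ _ _ cs1 hi1 he1) => //.
  - move=> q sa sb H [w [r1 b1 i1 sp1]]; exists w; split=> //.
    by apply: rows_agree r1 => k l; apply: H.
  - move=> q s' j cs' hj hi' [w [r1 b1 i1 sp1]].
    have [y [r2 b2 i2 sp2]] := step_spec phi_irr cs' hj r1 b1 i1.
    by exists y; split=> // g; rewrite sp2 sp1 -mulrA [nphi _ _ * _]mulrC.
  - exists (family_at 0 h id); split.
    + exact: load_spec cs.
    + by move=> a la; rewrite -[a]/(val (Ordinal la)) family_at_ord.
    + apply: independent_nz => c c0; apply: h_indep; rewrite -[RHS]c0.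
      by apply: eq_bigr => k _; rewrite family_at_ord.
    + by move=> g; rewrite mulr1; apply: hE; apply: family_at_ord.
set s3 := run count_prog s2.
have cs3 : inputs s3 by apply: inputs_run.
have hi3 : nmem s3 10 0 0 = i by rewrite !nframe.
split.
  rewrite nframe // /s3 (count_spec cs2 rw bw).
  apply: (count_nonzero_rows phi_irr phi_inj fs_key indep span _ iw sw).
  by move=> j; case: (he j).
rewrite (found_spec cs3 hi3 leir); apply: eq_bigr => k _; congr nat_of_bool.
by apply: eq_forallb => j; rewrite !nframe.
Qed.

(** [ks] is a ghost list: the program stores exponents only, and which indices of [fs] they belong
    to is known to the proof alone. *)
Definition unfound ks e : bool := [exists k, (k \notin ks) && (Phi e %| fs k)].

(** This is why the greedy search visits each factor once: a failed increment still fails after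
    other exponents have grown. *)
Lemma unfound_weaken ks e e' : (forall j : 'I_m, e j <= e' j)%N ->
  unfound ks e' -> unfound ks e.
Proof.
move=> le /existsP[k /andP[nk dv]]; apply/existsP; exists k; rewrite nk /=.
by apply: dvdp_trans dv; apply/Phi_dvd_Phi.
Qed.

(** Found elements of P never outnumber P, so the inequality says that all of P is found. *)
Lemma unfound_card ks (P : pred 'I_r) : uniq ks ->
  (#|P| <= count P ks)%N = ~~ [exists k, (k \notin ks) && P k].
Proof.
move=> uks; rewrite -size_filter; have uf : uniq (filter P ks) by rewrite filter_uniq.
rewrite -(card_uniqP uf); have sub : filter P ks \subset P.
  by apply/subsetP => k; rewrite mem_filter => /andP[].
have -> : (#|P| <= #|filter P ks|)%N = (P \subset filter P ks).
  by have [le <-] := subset_leqif_card sub; rewrite eqn_leq le.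
rewrite negb_exists; apply/subsetP/forallP => [H k|H k Pk].
  by rewrite negb_and negbK; case: (boolP (P k)) => [/H|]; rewrite ?orbT // mem_filter => /andP[_ ->].
rewrite mem_filter; have := H k; rewrite negb_and negbK.
by have -> : P k by []; rewrite orbF => ->.
Qed.

Lemma try_spec s i (j : 'I_m) ks : inputs s -> nmem s 10 0 0 = i -> nmem s 11 0 0 = j ->
  (i < r)%N -> (forall j' : 'I_m, nmem s 5 i j' <= delta)%N -> (nmem s 5 i j < delta)%N ->
  uniq ks -> [seq fs k | k <- ks] = mkseq (fun a => Phi (nmem s 5 a)) i ->
  forall a b, nmem (run try_prog s) 5 a b =
    if (a == i) && unfound ks (incr (nmem s 5 i) j) then incr (nmem s 5 i) j b
    else nmem s 5 a b.
Proof.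
move=> cs hi hj ltir le_e lt_ej uks Eks a b; rewrite /try_prog 2!run_seq.
set e := incr _ _; set s1 := run (PNSet 5 _ _ _) s.
have cs1 : inputs s1 by apply: inputs_run.
have hi1 : nmem s1 10 0 0 = i by rewrite nframe.
have hj1 : nmem s1 11 0 0 = j by rewrite nframe.
have E1 a' b' : nmem s1 5 a' b' = if a' == i then e b' else nmem s 5 a' b'.
  rewrite /s1 /run /= /upd /= hi hj /e /incr; case: (eqVneq a' i) => //= ->.
  by case: (eqVneq b' j) => [->|] //; rewrite addn0.
clearbody s1.
have [T1 T2] : nmem (run test_prog s1) 21 0 0 = #|[pred k | Phi e %| fs k]| /\
  nmem (run test_prog s1) 23 0 0 = count (fun k => Phi e %| fs k) ks.
  have [|T1 T2] := test_spec (e := e) cs1 hi1 (ltnW ltir).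
    move=> j'; rewrite E1 eqxx; split=> //; rewrite /e /incr.
    have := le_e j'; case: (eqVneq (j' : nat) j) => [->|]; rewrite ?addn0 //; lia.
  (* The comparison of exponent rows is translated, through [Eks] and [Phi_dvd_Phi], into
     divisibility of the found f_k. *)
  split=> //; rewrite T2 -[RHS](count_map fs (fun q => Phi e %| q)) Eks -sum1_count big_map.
  have <- : index_iota 0 i = iota 0 i by rewrite /index_iota subn0.
  rewrite big_mkord [RHS]big_mkcond /=; apply: eq_bigr => k _.
  rewrite -[RHS]/(nat_of_bool (Phi e %| Phi (nmem s 5 k))); congr nat_of_bool.
  apply/forallP/(Phi_dvd_Phi phi_irr phi_inj) => H j'; have := H j'.
    by rewrite !E1 eqxx ltn_eqF.
  by rewrite !E1 eqxx ltn_eqF.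
set s2 := run test_prog s1 in T1 T2 *.
have hi2 : nmem s2 10 0 0 = i by rewrite nframe.
have hj2 : nmem s2 11 0 0 = j by rewrite nframe.
have E2 a' b' : nmem s2 5 a' b' = if a' == i then e b' else nmem s 5 a' b' by rewrite nframe.
rewrite run_if /= T1 T2 unfound_card // -/(unfound ks e); case: (unfound ks e) => /=.
  by rewrite andbT E2.
rewrite andbF /run /= /upd /= hi2 hj2 !E2 eqxx.
case: (eqVneq a i) => [->|] //=; rewrite /e /incr eqxx addn1 subn1 /=.
by case: (eqVneq b j) => [->|] //; rewrite addn0.
Qed.

Lemma row_spec s i ks : inputs s -> nmem s 10 0 0 = i -> (i < r)%N ->
  uniq ks -> size ks = i -> [seq fs k | k <- ks] = mkseq (fun a => Phi (nmem s 5 a)) i ->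
  (forall b, nmem s 5 i b = 0%N) ->
  let s' := run (PFor 11 0 3 (PFor 12 0 2 try_prog)) s in
  [/\ forall a b, a != i -> nmem s' 5 a b = nmem s 5 a b,
      forall j : 'I_m, (nmem s' 5 i j <= delta)%N &
      exists2 k, k \notin ks & fs k = Phi (nmem s' 5 i)].
Proof.
move=> cs hi ltir uks sks Eks E0 s'.
have [[Hr _ HD Hm] _ _ _ _] := cs.
(* Exponents of factors below j can no longer be raised; the later ones are still 0. *)
pose Inv j s' := [/\ forall a b, a != i -> nmem s' 5 a b = nmem s 5 a b,
    forall j' : 'I_m, (nmem s' 5 i j' <= delta)%N,
    forall j', (j <= j')%N -> nmem s' 5 i j' = 0%N,
    unfound ks (nmem s' 5 i) &
    forall j' : 'I_m, (j' < j)%N -> ~~ unfound ks (incr (nmem s' 5 i) j')].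
have [H1 H2 _ H4 H5] : Inv (nmem s 0 3 0) s'.
  apply: run_for => //.
    split=> [//|j'|j' _||//]; [by rewrite /= /upd /= E0|by rewrite /= /upd /= E0|].
    have [k nk] : exists k, k \notin ks.
      apply/existsP; rewrite -negb_forall; apply: contraTN ltir => /forallP all_ks.
      have : (#|'I_r| <= #|ks|)%N by apply/subset_leq_card/subsetP => k _; apply: all_ks.
      by rewrite card_ord (card_uniqP uks) sks -leqNgt.
    apply/existsP; exists k; rewrite nk /=.
    rewrite (_ : Phi _ = 1) ?dvd1p //; apply: big1 => j' _.
    by rewrite /= /upd /= E0.
  rewrite Hm => jj s1 ltj hj1 hn1 hf1 [I1 I2 I3 I4 I5]; pose j : 'I_m := Ordinal ltj.
  have cs1 : inputs s1 by apply: inputs_agree hn1 hf1 cs.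
  have hi1 : nmem s1 10 0 0 = i by rewrite hn1.
  have [[_ _ HD1 _] _ _ _ _] := cs1.
  (* Either all t attempts succeeded or one failed, and then so do all that follow. *)
  pose K t s' := [/\ forall a b, a != i -> nmem s' 5 a b = nmem s 5 a b,
    forall b, b != j :> nat -> nmem s' 5 i b = nmem s1 5 i b,
    (nmem s' 5 i j <= t)%N,
    unfound ks (nmem s' 5 i) &
    (nmem s' 5 i j = t \/ ~~ unfound ks (incr (nmem s' 5 i) j))].
  have [K1 K2 K3 K4 K5] : K (nmem s1 0 2 0) (run (PFor 12 0 2 try_prog) s1).
    apply: run_for => //.
      by rewrite /K /= /upd /= I3 //; split=> //; left.
    rewrite HD1 => t s2 ltt ht hn2 hf2 [K1 K2 K3 K4 K5].
    have cs2 : inputs s2 by apply: inputs_agree hn2 hf2 cs1.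
    have hi2 : nmem s2 10 0 0 = i by rewrite hn2.
    have hj2 : nmem s2 11 0 0 = j by rewrite hn2.
    have Eks2 : [seq fs k | k <- ks] = mkseq (fun a => Phi (nmem s2 5 a)) i.
      rewrite Eks; apply/eq_in_map => a; rewrite mem_iota => /andP[_ lta].
      by apply: Phi_ext => j'; rewrite K1 // neq_ltn lta.
    have le2 (j' : 'I_m) : (nmem s2 5 i j' <= delta)%N.
      have [->|ne] := eqVneq j' j; first by rewrite (leq_trans K3) // ltnW.
      by rewrite K2.
    have T := try_spec cs2 hi2 hj2 ltir le2 (leq_ltn_trans K3 ltt) uks Eks2.
    set s3 := run try_prog s2 in T *.
    rewrite /K.
    have -> : nmem (set_var 12 t.+1 s3) 5 = nmem s3 5 by [].
    have [unf|nunf] := boolP (unfound ks (incr (nmem s2 5 i) j)).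
      have Ti b : nmem s3 5 i b = incr (nmem s2 5 i) j b by rewrite T eqxx unf.
      case: K5 => [K5|]; last by rewrite unf.
      split.
      - by move=> a b ne; rewrite T (negPf ne) /= K1.
      - by move=> b ne; rewrite Ti /incr (negPf ne) addn0 K2.
      - by rewrite Ti /incr eqxx addn1.
      - by apply: unfound_weaken unf => j'; rewrite Ti.
      - by left; rewrite Ti /incr eqxx addn1 K5.
    have Ti a b : nmem s3 5 a b = nmem s2 5 a b by rewrite T (negPf nunf) andbF.
    split.
    - by move=> a b ne; rewrite Ti K1.
    - by move=> b ne; rewrite Ti K2.
    - by rewrite Ti (leq_trans K3).
    - by apply: unfound_weaken K4 => j'; rewrite Ti.
    - right; apply: contra nunf; apply: unfound_weaken => j'.
      by rewrite /incr Ti.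
  set s2 := run _ s1 in K1 K2 K3 K4 K5 *.
  rewrite /Inv; have -> : nmem (set_var 11 jj.+1 s2) 5 = nmem s2 5 by [].
  rewrite HD1 in K3 K5.
  (* If all delta attempts succeeded, the degree of f_k excludes exponent delta + 1. *)
  have nunf : ~~ unfound ks (incr (nmem s2 5 i) j).
    case: K5 => // K5; apply/negP => /existsP[k /andP[_ dv]].
    have [/monic_neq0 fk0 sk] := fsP k.
    have : nphi phi j ^+ delta.+1 %| fs k.
      apply: dvdp_trans dv; have := nphi_exp_dvd_Phi phi (incr (nmem s2 5 i) j) j.
      by rewrite {1}/incr eqxx K5 addn1.
    move/(dvdp_leq fk0); have [sj _] := nphi_irr phi_irr j.
    by have := size_exp_lower delta.+1 sj; size_lia.
  split=> //.
  - move=> j'; have [->|ne] := eqVneq j' j; first by [].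
    by rewrite K2.
  - by move=> j' ltj'; rewrite K2 ?I3 //= ?neq_ltn ?ltj' ?orbT // ltnW.
  - move=> j'; rewrite ltnS leq_eqVlt => /orP[/eqP E|ltj'].
      by have -> : j' = j by apply: val_inj.
    apply: contra (I5 j' ltj'); apply: unfound_weaken => j''; rewrite /incr leq_add2r.
    have [->|ne] := eqVneq j'' j; first by rewrite I3.
    by rewrite K2.
split=> //.
have /existsP[k /andP[nk dv]] := H4; exists k => //.
have [monk _] := fsP k.
apply: (Phi_maximal phi_irr monk) => //; first exact: fs_factors.
move=> j; have := H5 j; rewrite Hm ltn_ord => /(_ isT); apply: contra => dvj.
by apply/existsP; exists k; rewrite nk.
Qed.

Lemma main_spec s : inputs s -> (forall a b, nmem s 5 a b = 0%N) ->
  uniq (output (run main_prog s)) /\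
  output (run main_prog s) =i [seq fs i ^+ d | i : 'I_r].
Proof.
move=> cs E0; have [[Hr _ _ _] _ _ _ _] := cs.
pose Inv i s' := exists ks, [/\ uniq ks, size ks = i,
   [seq fs k | k <- ks] = mkseq (fun a => Phi (nmem s' 5 a)) i,
   forall a b, (i <= a)%N -> nmem s' 5 a b = 0%N &
   forall a, (a < i)%N -> nmem s' 4 a 0 = N /\
     forall x, (x < N)%N -> fmem s' 2 a x = (Phi (nmem s' 5 a) ^+ d)`_x].
rewrite /main_prog run_seq; set p := PFor 10 0 0 _.
have [ks [uks sks Eks _ Hout]] : Inv (nmem s 0 0 0) (run p s).
  apply: run_for => //; first by exists [::]; split=> // a b _; rewrite /= /upd /= E0.
  rewrite Hr => i s1 ltir hi hn1 hf1 [ks [uks sks Eks Ez Hout]].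
  have cs1 : inputs s1 by apply: inputs_agree hn1 hf1 cs.
  rewrite run_seq.
  have [R1 R2 [k nk Ek]] := row_spec cs1 hi ltir uks sks Eks (fun b => Ez i b (leqnn i)).
  set s2 := run _ s1 in R1 R2 Ek *.
  have cs2 : inputs s2 by apply: inputs_run.
  have hi2 : nmem s2 10 0 0 = i by rewrite nframe.
  have [O1 O2 O3 O4] := out_spec (e := nmem s2 5 i) cs2 hi2 (fun j => conj erefl (R2 j)).
  have E3 a b : nmem (run out_prog s2) 5 a b = nmem s2 5 a b by rewrite nframe.
  set s3 := run out_prog s2 in O1 O2 O3 O4 E3 *.
  exists (rcons ks k).
  have -> : nmem (set_var 10 i.+1 s3) 5 = nmem s3 5 by [].
  have -> : nmem (set_var 10 i.+1 s3) 4 = nmem s3 4 by [].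
  have -> : fmem (set_var 10 i.+1 s3) 2 = fmem s3 2 by [].
  split.
  - by rewrite rcons_uniq nk.
  - by rewrite size_rcons sks.
  - rewrite /mkseq; have -> : iota 0 i.+1 = rcons (iota 0 i) i by rewrite -addn1 iotaD cats1.
    rewrite !map_rcons; congr rcons.
      rewrite Eks; apply/eq_in_map => a; rewrite mem_iota => /andP[_ lta].
      by apply: Phi_ext => j; rewrite E3 R1 // neq_ltn lta.
    by rewrite Ek; apply: Phi_ext => j; rewrite E3.
  - by move=> a b lta; rewrite E3 R1 ?Ez ?neq_ltn ?lta ?orbT // ltnW.
  - move=> a; rewrite ltnS leq_eqVlt => /orP[/eqP->|lta].
      have -> : Phi (nmem s3 5 i) = Phi (nmem s2 5 i) by apply: Phi_ext => j; rewrite E3.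
      by split=> // x ltx; rewrite O2.
    have ne : a != i by rewrite neq_ltn lta.
    have [Ha1 Ha2] := Hout a lta; rewrite O3 // nframe //; split=> // x ltx.
    have -> : Phi (nmem s3 5 a) = Phi (nmem s1 5 a) by apply: Phi_ext => j; rewrite E3 R1.
    by rewrite O1 // fframe // Ha2.
rewrite Hr in sks Eks Hout.
set s1 := run p s in sks Eks Hout *; set s2 := run _ s1.
have Hr1 : nmem s1 0 0 0 = r by rewrite nframe.
have c2 : nmem s2 3 0 0 = r by rewrite /s2 /run /= /upd /= Hr1.
have n2 a : nmem s2 4 a 0 = nmem s1 4 a 0 by rewrite nframe.
have f2 a x : fmem s2 2 a x = fmem s1 2 a x by rewrite fframe.
clearbody s1 s2.
have Eout : output s2 = [seq fs k ^+ d | k <- ks].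
  (* Output rows are padded with zeros to width N, and f_k^d fits, so nothing is truncated. *)
  transitivity (map (fun q : {poly F} => \poly_(x < N) (q ^+ d)`_x) [seq fs k | k <- ks]).
    rewrite Eks /output /mkseq -map_comp c2.
    apply/eq_in_map => a; rewrite mem_iota => /andP[_ lta] /=.
    have [Ha1 Ha2] := Hout a lta.
    rewrite n2 Ha1; apply/polyP => x; rewrite !coef_poly; case: ifP => // ltx.
    by rewrite f2 Ha2.
  rewrite -map_comp; apply: eq_map => k /=.
  apply/polyP => x; rewrite coef_poly; case: ltnP => // leNx.
  by rewrite nth_default // (leq_trans (fs_size k)).
rewrite Eout; have inj : injective (fun k => fs k ^+ d).
  move=> k1 k2 E; apply/eqP; apply: contraT => ne.
  have := indep (c := fun k => (k == k1)%:R - (k == k2)%:R) _ k1.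
  rewrite eqxx (negPf ne) subr0 => /(_ _)/eqP; rewrite oner_eq0; apply.
  under eq_bigr => k _ do rewrite scalerBl.
  rewrite sumrB (bigD1 k1) //= eqxx scale1r big1 => [|k /negPf->]; last by rewrite scale0r.
  rewrite (bigD1 k2) //= eqxx scale1r big1 => [|k /negPf->]; last by rewrite scale0r.
  by rewrite E subrr.
have all_ks k : k \in ks.
  have : ks =i predT.
    apply/subset_cardP => //; last exact/subsetP.
    by rewrite (card_uniqP uks) sks cardT size_enum_ord.
  by move=> ->.
split; first by rewrite map_inj_uniq.
move=> q; apply/mapP/imageP => [[k _ ->]|[k _ ->]]; by exists k.
Qed.

End Main.

(** * The loop limits, the running time and the conclusion *)

Lemma width_spec (F : fieldType) (r d delta m : nat) (h : 'I_r -> {poly F})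
    (phi : 'I_m -> {poly F}) :
  let s := run width_prog (init_state d delta h phi) in
  [/\ inputs d delta (d * delta).+1 h phi s, forall a b, nmem s 5 a b = 0%N &
      forall k, (nmem s 6 k 0 <= (d * delta).+1)%N].
Proof.
set s0 := init_state _ _ _ _ => s.
(* The other cells of array 6 are recorded as well, since [exec_run] asks for a bound on every cell
   (a, k, 0) of a parameter array. *)
have N6 : nmem s 6 0 0 = (d * delta).+1 /\ forall k, k != 0%N -> nmem s 6 k 0 = 0%N.
  rewrite /s /width_prog run_seq; set s1 := run _ s0.
  have d1 : nmem s1 0 1 0 = d by [].
  apply: (run_for (Inv := fun t s' => nmem s' 6 0 0 = (d * t).+1 /\
    forall k, k != 0%N -> nmem s' 6 k 0 = 0%N)) => //.
    by split=> [|k /negPf nk]; rewrite /s1 /run /= /upd /= ?muln0 ?nk.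
  move=> t s2 lt ht hn hf [I1 I2]; split=> [|k nk].
    by rewrite /run /= /upd /= I1 hn // d1 mulnS; lia.
  by rewrite /run /= /upd /= (negPf nk) /= I2.
have hn b k l : b \notin nwrites width_prog -> nmem s b k l = nmem s0 b k l by apply: nframe.
have hf b k l : fmem s b k l = fmem s0 b k l by apply: fframe.
split; last 2 first.
- by move=> a b; rewrite hn //= if_same.
- by move=> k; case: (eqVneq k 0%N) => [->|nk]; [rewrite N6.1|rewrite N6.2].
split; first by split; rewrite hn.
- by case: N6.
- by move=> j; rewrite hn //= /family_at valK.
- by move=> i x; rewrite hf /= /family_at valK.
- by move=> j x; rewrite hf /= /family_at valK.
Qed.

Lemma small_natr_neq0 (F : fieldType) p B : has_characteristic F p ->
  p = 0%N \/ (B < p)%N -> forall n, (0 < n <= B)%N -> n%:R != 0 :> F.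
Proof.
rewrite /has_characteristic => hp hB n /andP[n0 nB].
case: eqP hp hB => [-> /pcharf0P-> _|/eqP p0 cp [/eqP|ltBp]]; first by rewrite -lt0n.
  by rewrite (negPf p0).
by rewrite -(dvdn_pcharf cp) gtnNdvd // (leq_ltn_trans nB).
Qed.

Theorem theorem4p14 :
  exists (prog : cmd) (c k : nat),
  forall (F : fieldType) (p r d delta : nat)
    (f : {poly F}) (alpha : 'I_r -> F) (fs : 'I_r -> {poly F}),
  has_characteristic F p ->
  p = 0%N \/ (2 * d * r * delta < p)%N ->
  ((r.+1) ^ 4 * delta <= d)%N ->
  (forall i, fs i \is monic /\ (size (fs i) <= delta.+1)%N) ->
  f = \sum_(i < r) alpha i *: fs i ^+ d ->
  minimal_representation r d delta f ->
  forall (m : nat) (h : 'I_r -> {poly F}) (phi : 'I_m -> {poly F}),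
  is_basis (kerL p d f fs) h ->
  irreducible_factors (Qcoef d f fs ord_max) phi ->
  exists (s : state F) (t : nat),
    [/\ exec prog (init_state d delta h phi) s t,
        uniq (output s),
        output s =i [seq fs i ^+ d | i : 'I_r],
        p = 0%N -> (t <= c * (m + r + delta + d).+1 ^ k)%N
      & (0 < p)%N -> (t <= c * (m + r + delta + d + up_log 2 p).+1 ^ k)%N].
Proof.
have [K1 [k1 H1]] := cost_poly width_prog.
have [K2 [k2 H2]] := cost_poly main_prog.
(* The loop bound satisfies [B.+1 <= 2 * T.+1 ^ 2] because of the width d*delta + 1; this doubles
   the exponents and brings in the powers of 2. *)
exists algorithm, (K1 * 2 ^ k1 + K2 * 2 ^ k2)%N, (k1 + k1 + (k2 + k2)).+1.
move=> F p r d delta f alpha fs charp ltp le_d fsP Ef minf m h phi [hker hind hspan].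
move=> [phi_dvd phi_all phi_inj].
have sz_fs i : (size (fs i) <= delta.+1)%N by case: (fsP i).
have indep := minimal_independent sz_fs Ef minf.
have sz_fsd i : (size (fs i ^+ d) <= (d * delta).+1)%N by apply: size_exp_upper.
(* For r = 0 the hypothesis on p gives no bound on d*delta, so the bound is stated in the presence
   of an index. *)
have ltp' : (0 < r)%N -> p = 0%N \/ (d * delta < p)%N.
  by case: ltp => [|ltp] r0; [left|right; apply: leq_ltn_trans ltp; nia].
have charF (i : 'I_r) := small_natr_neq0 charp (ltp' (leq_ltn_trans (leq0n _) (ltn_ord i))).
have phi_irr j : irreducible_poly (phi j) by case: (phi_dvd j).
have span g : in_span h g <-> in_span (fun i => fs i ^+ d) g.
  have h1 i : in_span h (fs i ^+ d).
    apply: hspan; split; first exact: Lop_kill.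
    move=> p0; have [E|] := ltp' (leq_ltn_trans (leq0n _) (ltn_ord i)); first by rewrite E in p0.
    exact: leq_trans (sz_fsd i) .
  (* The basis of the kernel has exactly r elements, so the r independent powers it contains span
     it. *)
  have h2 := independent_same_span indep h1.
  have trans (u w : 'I_r -> {poly F}) : (forall i, in_span w (u i)) -> in_span u g -> in_span w g.
    move=> /fin_all_exists[C HC] [c ->]; exists (fun j => \sum_i c i * C i j).
    under eq_bigr => i _ do rewrite HC scaler_sumr.
    rewrite exchange_big; apply: eq_bigr => j _; rewrite scaler_suml.
    by apply: eq_bigr => i _; rewrite scalerA.
  by split; apply: trans.
have sz_h i : (size (h i) <= (d * delta).+1)%N.
  have [|c ->] := (span (h i)).1.
    exists (fun k => (k == i)%:R); rewrite (bigD1 i) //= eqxx scale1r big1 ?addr0 // => k ki.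
    by rewrite (negPf ki) scale0r.
  apply: (leq_trans (size_sum _ _ _)); apply/bigmax_leqP => k _.
  exact: leq_trans (size_scale_leq _ _) (sz_fsd k).
have [cs E0 le6] := width_spec d delta h phi.
set s0 := init_state _ _ _ _; set s1 := run width_prog s0 in cs E0 le6 *.
have [uout eout] : uniq (output (run main_prog s1)) /\
    output (run main_prog s1) =i [seq fs i ^+ d | i : 'I_r].
  apply: (main_spec phi_irr phi_inj fsP _ _ indep hind span sz_h sz_fsd cs E0).
    move=> k u iu uk; apply: phi_all => //.
    exact: (dvd_top_coef le_d fsP (charF k) (Lop_kill d f fs k) iu uk).
  by move=> u e c i0; apply: (dvd_combination le_d fsP (charF i0) indep).
(* B bounds every loop limit: the four input parameters and the width. *)
pose S := (m + r + delta + d)%N; pose B := (S + (d * delta).+1)%N.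
have le0 k : (nmem s0 0 k 0 <= B)%N.
  by rewrite /B /S; case: k => [|[|[|[|[|k]]]]] /=; lia.
have [t1 e1 l1] : exists2 t, exec (compile width_prog) s0 s1 t & (t <= cost B width_prog)%N.
  by apply: exec_run wf_width _ => a k; rewrite inE => /eqP->.
have [t2 e2 l2] : exists2 t, exec (compile main_prog) s1 (run main_prog s1) t &
    (t <= cost B main_prog)%N.
  apply: exec_run wf_main _ => a k; rewrite !inE => /orP[] /eqP->.
    by rewrite nframe.
  exact: leq_trans (le6 k) (leq_addl _ _).
have le_t T : (S <= T)%N ->
    (t1 + t2 <= (K1 * 2 ^ k1 + K2 * 2 ^ k2) * T.+1 ^ (k1 + k1 + (k2 + k2)).+1)%N.
  move=> leST; have leB : (B.+1 <= 2 * T.+1 ^ 2)%N.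
    apply: (@leq_trans (2 * S.+1 ^ 2)%N).
      by rewrite /B /S expnS expn1; nia.
    by rewrite leq_mul2l leq_exp2r.
  have pow K k l : (k + k <= l)%N -> (K * B.+1 ^ k <= K * 2 ^ k * T.+1 ^ l)%N.
    move=> lekl; rewrite -mulnA leq_mul2l; apply/orP; right.
    apply: (@leq_trans ((2 * T.+1 ^ 2) ^ k)%N).
      by case: k {lekl} => // k; rewrite leq_exp2r.
    rewrite expnMn -expnM leq_mul2l mul2n -addnn; apply/orP; right.
    by rewrite leq_pexp2l.
  rewrite mulnDl; apply: leq_add.
    by apply: (leq_trans l1); apply: (leq_trans (H1 B)); apply: pow; lia.
  by apply: (leq_trans l2); apply: (leq_trans (H2 B)); apply: pow; lia.
exists (run main_prog s1), (t1 + t2)%N; split=> //.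
- exact: ExecSeq e1 e2.
- by move=> _; apply: le_t.
- by move=> _; apply: le_t; rewrite leq_addr.
Qed.
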